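(* Let $I=[0,1]$ or $I=[0,\infty)$ and let $X$ be a Banach r.i. space on $I$. Then $$\mathcal{LI}(X,M^*(X);L^\infty)=\mathcal{QLI}(X,M^*(X);L^\infty)=\mathcal{M}(X,M^*(X)),$$ and, if $I=[0,1]$, these classes are also equal to $\mathcal{LPI}(X,M^*(X);L^\infty)$. Furthermore, a couple of spaces $(Y,Z)$ belongs to any of these classes if and only if the quasilinear operator $Q_X$ defined by $$Q_X\varphi(t)=\frac{1}{\phi_X(t)}\,\|\varphi\,\chi_{[0,t]}\|_X$$ is bounded from $Y$ into $Z$ for nonnegative and nonincreasing functions, i.e. there is a constant $K$ with $\|Q_X\varphi\|_Z\le K\|\varphi\|_Y$ for all nonnegative nonincreasing $\varphi\in Y$.
   Context: All functions are real-valued Lebesgue measurable on $I$; $f^*$ is the nonincreasing rearrangement of $f$. A Banach r.i. (rearrangement invariant) space on $I$ is a Banach space $(X,\|\cdot\|)$ of locally integrable functions on $I$ such that: (i) $|g|\le|f|$ a.e., $f\in X$ imply $g\in X$, $\|g\|\le\|f\|$; (ii) (Fatou) $0\le f_n\uparrow$, $\sup_n\|f_n\|<\infty$ imply $f=\sup f_n\in X$ and $\|f\|=\sup_n\|f_n\|$; (iii) $X$ contains the simple integrable functions; (iv) $f\in X\iff f^*\in X$, and $\|f\|=\|f^*\|$. A quasi-Banach r.i. space is a complete quasi-normed space of measurable functions satisfying (i)-(iv) (the triangle inequality holds with a constant; local integrability is not required). The fundamental function of $X$ is $\phi_X(t)=\|\chi_{[0,t]}\|_X$; for Banach r.i. $X$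 it is assumed (without loss of generality, up to equivalent renorming) positive for $t>0$, nondecreasing, concave and absolutely continuous away from the origin. $M^*(X)$ is the space of measurable $f$ with $\|f\|_{M^*(X)}=\sup_{t\in I}\phi_X(t)f^*(t)<\infty$ (a quasi-norm). Let $(A_0,A_1)$ be a couple of quasi-Banach r.i. spaces. The classes below consist of couples $(X_0,X_1)$ of quasi-Banach r.i. spaces on $I$ with $A_i\cap L^\infty\hookrightarrow X_i\hookrightarrow A_i+L^\infty$ (continuous embeddings), $i=0,1$; ''couple of spaces'' in the claim means such a couple. $\mathcal{LI}(A_0,A_1;L^\infty)$ [resp. $\mathcal{QLI}(A_0,A_1;L^\infty)$]: every linear [resp. quasilinear] operator $T:A_0+L^\infty\to A_1+L^\infty$ that is bounded from $A_0$ into $A_1$ and from $L^\infty$ into $L^\infty$ is also bounded from $X_0$ into $X_1$. Here $T$ is quasilinear if $|T(\lambda f)|=|\lambda||Tf|$ and $|T(f+g)|\le K(|Tf|+|Tg|)$ for some constant $K\ge 1$; bounded means $\|Tf\|\le C\|f\|$ for some $C$. $\mathcal{LPI}(A_0,A_1;L^\infty)$: every operator $T:A_0+L^\infty\to A_1+L^\infty$ that is a Lipschitz operator from $A_0$ into $A_1$ and from $L^\infty$ into $L^\infty$ also maps $X_0$ into $X_1$. Here $T:E\to F$ is a Lipschitz operator if $T(0)=0$ and $\|Tf-Tg\|_F\le C\|f-g\|_E$ for some constant $C$. $\mathcal{M}(A_0,A_1)$: there is a constant $C\ge1$ such that whenever $f\in X_0$, $g\in A_1+L^\infty$ and $\|f^*\chi_{[0,t]}\|_{A_0}\ge\|g^*\chi_{[0,t]}\|_{A_1}$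 for all $t>0$, then $g\in X_1$ and $\|g\|_{X_1}\le C\|f\|_{X_0}$. *)

(* Defs.v *)
From HB Require Import structures.
From mathcomp Require Import all_boot all_order all_algebra.
From mathcomp Require Import all_classical all_reals all_analysis.

Set Implicit Arguments.
Unset Strict Implicit.
Unset Printing Implicit Defensive.

Import Order.TTheory GRing.Theory Num.Theory.
Import numFieldNormedType.Exports HBSimple.

Local Open Scope classical_set_scope.
Local Open Scope ring_scope.

(* The real line with the Lebesgue (Caratheodory) sigma-algebra; the default
   sigma-algebra of the library on R is the Borel one. *)
Definition lebR (R : realType) :=
  caratheodory_type ((wlength (idfun : R -> R))^*)%mu.

Lemma measurable_itv_lebR (R : realType) (J : interval R) :
  measurable ([set` J] : set (lebR R)).
Proof. by apply: sub_caratheodory; exact: measurable_itv. Qed.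

(* A function on J is a map R -> R of which only the values on J matter. As the
   measure [mu J] is carried by J, "almost everywhere" always means a.e. on J. *)
Definition mu (R : realType) (J : interval R) :
    {measure set (lebR R) -> \bar R} :=
  mrestr (@completed_lebesgue_measure R) (measurable_itv_lebR J).

Definition lmeasurable (R : realType) (J : interval R) (f : R -> R) : Prop :=
  measurable_fun ([set` J] : set (lebR R)) (f : lebR R -> R).

(* A space (X, ||.||) is encoded by the functional that is ||f|| on X and +oo
   outside X; its elements are the measurable functions of finite norm. *)
Definition fspace (R : realType) := (R -> R) -> \bar R.

Definition in_space (R : realType) (J : interval R) (X : fspace R)
  (f : R -> R) : Prop := lmeasurable J f /\ (X f < +oo)%E.

(* f^*, which takes the value +oo at 0 when f is unbounded, and everywhere when
   all the level sets of f have infinite measure. *)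
Definition rearr (R : realType) (J : interval R) (f : R -> R) (t : R) : \bar R :=
  ereal_inf (EFin @` [set l : R |
    0 <= l /\ (mu J [set x | (l < `|f x|)%R] <= t%:E)%E]).

Definition rstar (R : realType) (J : interval R) (f : R -> R) (t : R) : R :=
  fine (rearr J f t).

Definition trunc (R : realType) (f : R -> R) (t : R) : R -> R :=
  fun x => f x * \1_([set` `[0, t]]) x.

(* Rearrangement invariant spaces whose triangle inequality holds with the
   constant K. In [ri_fatou] and [ri_rearr] the functions sup_n u_n and f^* may
   be infinite a priori: belonging to the space includes being real-valued
   a.e. (f^* is then finite on all of J except possibly at 0). *)
Record ri_space (R : realType) (J : interval R) (K : R) (X : fspace R) : Prop := {
  ri_ge0 : forall f, in_space J X f -> (0 <= X f)%E;
  ri_eq0 : forall f, in_space J X f -> X f = 0%E <-> f = cst 0 %[ae mu J];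
  ri_scale : forall (a : R) f, in_space J X f ->
    in_space J X (fun x => a * f x) /\
    X (fun x => a * f x) = (`|a|%R%:E * X f)%E;
  ri_add : forall f g, in_space J X f -> in_space J X g ->
    in_space J X (f \+ g) /\ (X (f \+ g)%R <= K%:E * (X f + X g))%E;
  ri_complete : forall u : nat -> R -> R, (forall n, in_space J X (u n)) ->
    (forall e : R, 0 < e -> exists N, forall m n, (N <= m)%N -> (N <= n)%N ->
      (X (u m \- u n)%R < e%:E)%E) ->
    exists2 f, in_space J X f & X (u n \- f) @[n --> \oo] --> 0%E;
  ri_ideal : forall f g, in_space J X f -> lmeasurable J g ->
    (\forall x \ae mu J, `|g x| <= `|f x|) ->
    in_space J X g /\ (X g <= X f)%E;
  ri_fatou : forall u : nat -> R -> R, (forall n, in_space J X (u n)) ->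
    (forall n, \forall x \ae mu J, 0 <= u n x) ->
    (forall n, \forall x \ae mu J, u n x <= u n.+1 x) ->
    (ereal_sup (range (fun n => X (u n))) < +oo)%E ->
    let s (x : R) := ereal_sup (range (fun n => (u n x)%:E)) in
    [/\ \forall x \ae mu J, s x \is a fin_num,
        in_space J X (fine \o s) &
        X (fine \o s) = ereal_sup (range (fun n => X (u n)))];
  ri_simple : forall s : {sfun (lebR R) >-> R},
    (mu J).-integrable setT (EFin \o s) -> in_space J X s;
  ri_rearr : forall f, lmeasurable J f ->
    (in_space J X f <->
      (forall t, t \in J -> 0 < t -> (rearr J f t < +oo)%E) /\
      in_space J X (rstar J f)) /\
    (in_space J X f -> X f = X (rstar J f)) }.

Definition quasi_banach_ri (R : realType) (J : interval R) (X : fspace R) : Prop :=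
  exists2 K : R, 1 <= K & ri_space J K X.

Definition banach_ri (R : realType) (J : interval R) (X : fspace R) : Prop :=
  ri_space J 1 X /\
  (forall f, in_space J X f -> forall K : set R, compact K -> K `<=` [set` J] ->
    (@completed_lebesgue_measure R).-integrable (K : set (lebR R)) (EFin \o f)).

Definition fundamental (R : realType) (X : fspace R) (t : R) : R :=
  fine (X \1_([set` `[0, t]])).

Definition absolutely_continuous (R : realType) (f : R -> R) (a b : R) : Prop :=
  forall e : R, 0 < e -> exists2 d : R, 0 < d &
    forall (n : nat) (s t : 'I_n -> R),
      (forall i, a <= s i /\ s i <= t i /\ t i <= b) ->
      trivIset setT (fun i => [set` `]s i, t i[]) ->
      \sum_(i < n) (t i - s i) < d ->
      \sum_(i < n) `|f (t i) - f (s i)| < e.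

Record regular_fundamental (R : realType) (J : interval R) (X : fspace R) : Prop := {
  fundamental_gt0 : forall t, t \in J -> 0 < t -> 0 < fundamental X t;
  fundamental_nondecreasing : {in J &, {homo fundamental X : s t / s <= t}};
  fundamental_concave :
    @convex_function R R^o [set` J] (fun t => - fundamental X t);
  fundamental_ac : forall a b, a \in J -> b \in J -> 0 < a ->
    absolutely_continuous (fundamental X) a b }.

Definition Mstar (R : realType) (J : interval R) (X : fspace R) : fspace R :=
  fun f => ereal_sup [set ((fundamental X t)%:E * rearr J f t)%E | t in [set` J]].

Definition Linfty (R : realType) (J : interval R) : fspace R :=
  fun f => ('N[mu J]_+oo[EFin \o (f : lebR R -> R)])%E.

Definition sum_space (R : realType) (J : interval R) (A B : fspace R) : fspace R :=
  fun f => ereal_inf [set z | exists a b,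
    [/\ in_space J A a, in_space J B b, f = a \+ b %[ae mu J] &
        z = (A a + B b)%E]].

Definition inter_space (R : realType) (A B : fspace R) : fspace R :=
  fun f => maxe (A f) (B f).

Definition bounded_op (R : realType) (J : interval R) (E F : fspace R)
    (T : (R -> R) -> R -> R) : Prop :=
  exists C : R, forall f, in_space J E f ->
    in_space J F (T f) /\ (F (T f) <= C%:E * E f)%E.

Definition embeds (R : realType) (J : interval R) (E F : fspace R) : Prop :=
  bounded_op J E F id.

(* A map between spaces of functions modulo a.e. equality, given by its action
   on representatives. *)
Definition operator (R : realType) (J : interval R) (E F : fspace R)
    (T : (R -> R) -> R -> R) : Prop :=
  (forall f, in_space J E f -> in_space J F (T f)) /\
  (forall f g, in_space J E f -> in_space J E g ->
    f = g %[ae mu J] -> T f = T g %[ae mu J]).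

Definition linear_op (R : realType) (J : interval R) (E : fspace R)
    (T : (R -> R) -> R -> R) : Prop :=
  forall (a : R) f g, in_space J E f -> in_space J E g ->
    T (fun x => a * f x + g x) = (fun x => a * T f x + T g x) %[ae mu J].

Definition quasilinear_op (R : realType) (J : interval R) (E : fspace R)
    (T : (R -> R) -> R -> R) : Prop :=
  (forall (a : R) f, in_space J E f ->
    \forall x \ae mu J, `|T (fun y => a * f y) x| = `|a| * `|T f x|) /\
  (exists2 K : R, 1 <= K & forall f g, in_space J E f -> in_space J E g ->
    \forall x \ae mu J, `|T (f \+ g) x| <= K * (`|T f x| + `|T g x|)).

Definition lipschitz_op (R : realType) (J : interval R) (E F : fspace R)
    (T : (R -> R) -> R -> R) : Prop :=
  [/\ forall f, in_space J E f -> in_space J F (T f),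
      T (cst 0) = cst 0 %[ae mu J] &
      exists C : R, forall f g, in_space J E f -> in_space J E g ->
        (F (T f \- T g)%R <= C%:E * E (f \- g)%R)%E].

Definition admissible_couple (R : realType) (J : interval R) (A0 A1 : fspace R)
    (XX : fspace R * fspace R) : Prop :=
  [/\ quasi_banach_ri J XX.1, quasi_banach_ri J XX.2,
      embeds J (inter_space A0 (Linfty J)) XX.1 /\
      embeds J XX.1 (sum_space J A0 (Linfty J)) &
      embeds J (inter_space A1 (Linfty J)) XX.2 /\
      embeds J XX.2 (sum_space J A1 (Linfty J))].

Definition class_LI (R : realType) (J : interval R) (A0 A1 : fspace R) :
    set (fspace R * fspace R) :=
  [set XX | admissible_couple J A0 A1 XX /\
    forall T, operator J (sum_space J A0 (Linfty J)) (sum_space J A1 (Linfty J)) T ->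
      linear_op J (sum_space J A0 (Linfty J)) T ->
      bounded_op J A0 A1 T -> bounded_op J (Linfty J) (Linfty J) T ->
      bounded_op J XX.1 XX.2 T].

Definition class_QLI (R : realType) (J : interval R) (A0 A1 : fspace R) :
    set (fspace R * fspace R) :=
  [set XX | admissible_couple J A0 A1 XX /\
    forall T, operator J (sum_space J A0 (Linfty J)) (sum_space J A1 (Linfty J)) T ->
      quasilinear_op J (sum_space J A0 (Linfty J)) T ->
      bounded_op J A0 A1 T -> bounded_op J (Linfty J) (Linfty J) T ->
      bounded_op J XX.1 XX.2 T].

Definition class_LPI (R : realType) (J : interval R) (A0 A1 : fspace R) :
    set (fspace R * fspace R) :=
  [set XX | admissible_couple J A0 A1 XX /\
    forall T, operator J (sum_space J A0 (Linfty J)) (sum_space J A1 (Linfty J)) T ->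
      lipschitz_op J A0 A1 T -> lipschitz_op J (Linfty J) (Linfty J) T ->
      forall f, in_space J XX.1 f -> in_space J XX.2 (T f)].

Definition class_M (R : realType) (J : interval R) (A0 A1 : fspace R) :
    set (fspace R * fspace R) :=
  [set XX | admissible_couple J A0 A1 XX /\
    exists2 C : R, 1 <= C &
    forall f g, in_space J XX.1 f -> in_space J (sum_space J A1 (Linfty J)) g ->
      (forall t : R, 0 < t ->
        (A1 (trunc (rstar J g) t) <= A0 (trunc (rstar J f) t))%E) ->
      in_space J XX.2 g /\ (XX.2 g <= C%:E * XX.1 f)%E].

Definition QX (R : realType) (X : fspace R) (f : R -> R) (t : R) : R :=
  (fundamental X t)^-1 * fine (X (trunc f t)).

(* Monotonicity is imposed away from 0 only: a nonincreasing function on J may be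
   unbounded near 0, whereas our functions are real-valued at 0. *)
Definition QX_bounded (R : realType) (J : interval R) (X Y Z : fspace R) : Prop :=
  exists K : R, forall f, in_space J Y f ->
    (forall t, t \in J -> 0 < t -> 0 <= f t) ->
    (forall s t, s \in J -> t \in J -> 0 < s -> s <= t -> f t <= f s) ->
    in_space J Z (QX X f) /\ (Z (QX X f) <= K%:E * Y f)%E.

(* Main.v *)
(* Everything is compared with the boundedness of Q_X on decreasing functions.
   If Q_X is bounded, the hypothesis of M at t together with
   phi(t) <= 2 phi(t/2) gives g^*(t) <= 2 Q_X f^*(t), hence M. If M holds and T
   is quasilinear (or Lipschitz), splitting f at the height f^*(t) bounds the
   M^*(X)-norm of (Tf)^* 1_[0,t] by a multiple of the X-norm of f^* 1_[0,t].
   Conversely, for a fixed f0 in Y, Hahn-Banach functionals h_s of norm 1 on X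
   that norm f0 1_[0,s], with s = tau(t) the least power of 2 above t, give one
   linear operator T f(t) = h_s(f 1_[0,s]) / phi(s), bounded from X to M^*(X)
   and on L^oo, with Q_X f0 <= 2 T f0. As T depends on f0, this only shows that
   Q_X maps Y into Z; boundedness follows by a gliding hump. *)
Require Import Defs.
From mathcomp Require Import all_boot all_order all_algebra.
From mathcomp Require Import all_classical all_reals all_analysis.
From mathcomp Require Import measurable_realfun ess_sup_inf ring lra.
Import Order.TTheory GRing.Theory Num.Theory.
Set Implicit Arguments.
Unset Strict Implicit.
Unset Printing Implicit Defensive.
Local Open Scope classical_set_scope.
Local Open Scope ring_scope.

(** The functionals [h_s] are chosen with no control on how they vary with [s], so a formula using
    [h_t] for every real [t] need not be measurable in [t]. Rounding [t] up to a power of 2 leaves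
    countably many functionals and makes [T f] constant on each dyadic interval, hence measurable
    whatever the choice. The price is a factor 2, because [phi] at most doubles when its argument
    does. The target M^*(X) suits this operator: the norm bound on [h_s] controls [T f] pointwise by
    ||f||_X / phi(t), and a function so bounded has M^*(X)-norm at most ||f||_X. The same operator
    serves the Lipschitz class, since a bounded linear operator is Lipschitz. That class promises
    only that Y is mapped into Z, with no norm estimate, so the boundedness of Q_X has to be
    extracted from a mere inclusion in any case. *)

(** * Hahn-Banach for a seminorm on a subspace *)

Section hahn_banach.
Context {R : realType} {V : lmodType R} {D : set V} {p : V -> R}.
Hypotheses (D0 : D 0) (DL : forall a u v, D u -> D v -> D (a *: u + v)).
Hypotheses (pZ : forall a u, D u -> p (a *: u) = `|a| * p u)
  (pD : forall u v, D u -> D v -> p (u + v) <= p u + p v).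

(* Graphs of linear functionals below p; p 0 = 0 makes them single-valued. *)
Let dominated (x0 : V) (A : set (V * R)) :=
  [/\ forall z, A z -> D z.1 /\ z.2 <= p z.1,
      forall a y z, A y -> A z -> A (a *: y.1 + z.1, a * y.2 + z.2) &
      A (x0, p x0)].

Let p0 : p 0 = 0.
Proof. by rewrite -(scale0r (0 : V)) pZ// normr0 mul0r. Qed.

Let DZ a u : D u -> D (a *: u).
Proof. by move=> Du; rewrite -[_ *: _]addr0; exact: DL. Qed.

Let DD u v : D u -> D v -> D (u + v).
Proof. by move=> Du Dv; rewrite -[u]scale1r; exact: DL. Qed.

Let pN u : D u -> p (- u) = p u.
Proof. by move=> Du; rewrite -scaleN1r pZ// normrN1 mul1r. Qed.

Let p_ge0 u : D u -> 0 <= p u.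
Proof.
move=> Du; have := pD Du (DZ (-1) Du); rewrite scaleN1r subrr p0 pN//.
by move=> ?; lra.
Qed.

Let dominated_line x0 : D x0 ->
  dominated x0 [set z | exists a, z = (a *: x0, a * p x0)].
Proof.
move=> Dx0; split=> /=.
- move=> _ [a ->] /=; split; first exact: DZ.
  by rewrite pZ// ler_wpM2r ?p_ge0// ler_norm.
- move=> a _ _ [b ->] [c ->] /=; exists (a * b + c).
  by rewrite scalerDl scalerA mulrDl mulrA.
- by exists 1; rewrite scale1r mul1r.
Qed.

Let dominated_extend x0 A y : dominated x0 A -> D y ->
  (forall r, ~ A (y, r)) -> exists2 B, A `<` B & dominated x0 B.
Proof.
move=> [AD AL Ax0] Dy yA.
have A00 : A (0, 0).
  have := AL (-1) _ _ Ax0 Ax0.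
  by rewrite /= scaleN1r mulN1r !addNr.
pose S := [set z.2 - p (z.1 - y) | z in A].
(* Domination at the sum of [u.1] and [v.1], split as [(u.1 - y) + (v.1 + y)], separates the lower
   constraints on a value at [y] from the upper ones. The supremum [c] lies in the gap. *)
have key u v : A u -> A v -> u.2 - p (u.1 - y) <= p (v.1 + y) - v.2.
  move=> Au Av; have [_] := AD _ (AL 1 _ _ Au Av).
  have [Du _] := AD _ Au; have [Dv _] := AD _ Av.
  rewrite /= scale1r mul1r => h.
  have DNy : D (- y) by rewrite -scaleN1r; exact: DZ.
  have := pD (DD Du DNy) (DD Dv Dy).
  by rewrite addrACA addNr addr0 => ?; lra.
have S0 : S !=set0 by eexists; exists (0, 0).
pose c := sup S.
have cl u : A u -> u.2 - p (u.1 - y) <= c.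
  move=> Au; apply: ub_le_sup; last by exists u.
  by exists (p (0 + y) - 0) => _ [v Av <-]; exact: (key _ (0, 0)).
have cr u : A u -> c <= p (u.1 + y) - u.2.
  by move=> Au; apply: ge_sup => // _ [v Av <-]; exact: key.
have AZ a u : A u -> A (a *: u.1, a * u.2).
  by move=> Au; have := AL a _ _ Au A00; rewrite /= !addr0.
exists [set z | exists2 u, A u & exists a, z = (u.1 + a *: y, u.2 + a * c)].
  split.
    by move=> /= [u r] Aur; exists (u, r) => //; exists 0; rewrite scale0r mul0r !addr0.
  move=> /(_ (y, c)) h; apply: (yA c); apply: h.
  by exists (0, 0) => //; exists 1; rewrite scale1r mul1r !add0r.
split=> /=.
- move=> _ [u Au [a ->]] /=; have [Du up] := AD _ Au; split.
    by apply: DD => //; exact: DZ.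
  (* Dividing by [|a|] reduces the bound to coefficient -1 or 1 of [y], that is to [cl] or [cr]. *)
  have [a0|a0|->] := ltgtP a 0; last by rewrite scale0r mul0r !addr0.
  + have b0 : 0 < - a by rewrite oppr_gt0.
    have := cl _ (AZ (- a)^-1 _ Au) => /=.
    rewrite -(ler_pM2l b0) mulrBr mulrA divff ?gt_eqF// mul1r.
    rewrite -[X in X * p _]gtr0_norm// -pZ; last first.
      by apply: DD; [exact: DZ|rewrite -scaleN1r; exact: DZ].
    rewrite scalerBr scalerA divff ?gt_eqF// scale1r scaleNr opprK.
    by move=> ?; lra.
  + have := cr _ (AZ a^-1 _ Au) => /=.
    rewrite -(ler_pM2l a0) mulrBr mulrA divff ?gt_eqF// mul1r.
    rewrite -[X in X * p _]gtr0_norm// -pZ; last by apply: DD => //; exact: DZ.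
    rewrite scalerDr scalerA divff ?gt_eqF// scale1r.
    by move=> ?; lra.
- move=> a _ _ [u Au [b ->]] [v Av [b' ->]] /=.
  exists (a *: u.1 + v.1, a * u.2 + v.2); first exact: AL.
  exists (a * b + b') => /=; congr pair; last by ring.
  by rewrite scalerDr scalerA addrACA -scalerDl.
- by exists (x0, p x0) => //; exists 0; rewrite scale0r mul0r !addr0.
Qed.

Lemma hahn_banach_norming x0 : D x0 -> exists h : V -> R,
  [/\ forall a u v, D u -> D v -> h (a *: u + v) = a * h u + h v,
      forall u, D u -> `|h u| <= p u & h x0 = p x0].
Proof.
move=> Dx0; pose P A := A = set0 \/ dominated x0 A.
have [F FP totF|A [PA maxA]] := @Zorn_bigcup _ P.
  have [F0|/existsNP[B /not_implyP[FB B0]]] := pselect (forall B, F B -> B = set0).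
    by left; apply/seteqP; split=> // z [B /F0 ->].
  have dom C z : F C -> C z -> dominated x0 C.
    by move=> FC Cz; have [C0|//] := FP _ FC; rewrite C0 in Cz.
  have {B0} dB : dominated x0 B by case: (FP _ FB).
  right; split.
  - by move=> z [C FC Cz]; have [+ _ _] := dom _ _ FC Cz; exact.
  - move=> a y z [C FC Cy] [E FE Ez].
    have [CE|EC] := totF _ _ FC FE.
    + by exists E => //; have [_ + _] := dom _ _ FE Ez; apply => //; exact: CE.
    + by exists C => //; have [_ + _] := dom _ _ FC Cy; apply => //; exact: EC.
  - by exists B => //; case: dB.
have {PA} dA : dominated x0 A.
  case: PA => // A0; have dL := dominated_line Dx0.
  case: (maxA _ _ (or_intror dL)); rewrite A0; split=> // h.
  by have [_ _ /h] := dL.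
have tot u : D u -> exists r, A (u, r).
  move=> Du; apply: contrapT => /forallNP uA.
  by have [B AB dB] := dominated_extend dA Du uA; exact: (maxA _ AB (or_intror dB)).
have [AD AL Ax0] := dA.
have fun_le u r s : A (u, r) -> A (u, s) -> s <= r.
  move=> Ar As; have [_] := AD _ (AL (-1) _ _ Ar As).
  by rewrite /= scaleN1r addNr p0 => ?; lra.
pose h u := xget 0 [set r | A (u, r)].
have hA u : D u -> A (u, h u).
  by move=> /tot[r Ar]; exact: (@xgetPex _ 0 [set r | A (u, r)] (ex_intro _ r Ar)).
have hE u r : A (u, r) -> h u = r.
  move=> Ar; have Ah : A (u, h u) by apply: hA; exact: (AD _ Ar).1.
  by apply/eqP; rewrite eq_le !(fun_le u).
exists h; split; last exact: hE.
- by move=> a u v Du Dv; apply: hE; exact: (AL a _ _ (hA _ Du) (hA _ Dv)).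
- move=> u Du; have [_ /= hu] := AD _ (hA _ Du).
  (* The lower bound on [h u] is the upper bound at [- u], where [p] takes the same value. *)
  have := AL (-1) _ _ (hA _ Du) (hA _ D0) => /AD[_] /=.
  rewrite addr0 (hE 0 0); last first.
    by have := AL (-1) _ _ Ax0 Ax0; rewrite /= scaleN1r mulN1r !addNr.
  by rewrite scaleN1r pN// => ?; rewrite ler_norml; apply/andP; split; lra.
Qed.

End hahn_banach.

(** * Lebesgue measure on [J] and almost-everywhere reasoning *)

Section interval_measure.
Context {R : realType} {J : interval R}.
Hypothesis hJ : J = `[0, 1] \/ J = `[0, +oo[.
Local Notation mu := (mu J).

Lemma in_dom0 : 0 \in J.
Proof. by case: hJ => ->; rewrite in_itv /= lexx ?ler01. Qed.

Lemma in_dom_ge0 t : t \in J -> 0 <= t.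
Proof. by case: hJ => ->; rewrite in_itv /= => /andP[]. Qed.

Lemma in_dom_le s t : t \in J -> 0 <= s -> s <= t -> s \in J.
Proof.
case: hJ => ->; rewrite !in_itv /= => /andP[_ t1] -> st //.
exact: le_trans t1.
Qed.

(** [mu] is computed by an outer measure, which is monotone on arbitrary sets. Level sets can thus
    be compared without any measurability side condition. *)
Lemma mu_le_sub (A B : set R) : A `&` [set` J] `<=` B -> (mu A <= mu B)%E.
Proof.
move=> AB; apply: le_outer_measure => x [Ax Jx].
by split => //; exact: AB.
Qed.

Lemma muU_le (A B : set R) : (mu (A `|` B) <= mu A + mu B)%E.
Proof. by rewrite /Defs.mu /= /mrestr setIUl; exact: outer_measureU2. Qed.

Lemma negligible_mu0 (N : set R) : mu.-negligible N -> mu N = 0%E.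
Proof.
move=> [A [mA A0 NA]]; apply/eqP; rewrite eq_le measure_ge0 andbT.
by rewrite -A0; apply: mu_le_sub => x [/NA].
Qed.

Lemma mu_le_ae (A B : set R) :
  (\forall x \ae mu, A x -> B x) -> (mu A <= mu B)%E.
Proof.
move=> /negligible_mu0 N0.
apply: (@le_trans _ _ (mu (B `|` ~` [set x | A x -> B x]))).
  apply: mu_le_sub => x [Ax _]; have [Bx|nBx] := pselect (B x); first by left.
  by right => /(_ Ax).
by apply: le_trans (muU_le _ _) _; rewrite N0 adde0.
Qed.

Lemma completed_lebesgue_measure_itv (i : interval R) :
  completed_lebesgue_measure ([set` i] : set (lebR R)) =
  lebesgue_measure [set` i].
Proof. by []. Qed.

Lemma mu_itv0c t : 0 <= t -> (mu `[0%R, t]%classic <= t%:E)%E.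
Proof.
move=> t0; apply: (@le_trans _ _ (completed_lebesgue_measure
  ([set` `[0, t]] : set (lebR R)))).
  by apply: le_outer_measure; exact: subIsetl.
by rewrite completed_lebesgue_measure_itv lebesgue_measure_itv /= lte_fin; case: ifPn => _;
  rewrite ?oppr0 ?adde0 ?lee_fin.
Qed.

Lemma mu_itvoc t : t \in J -> 0 < t -> mu `]0%R, t]%classic = t%:E.
Proof.
move=> tJ t0; transitivity (completed_lebesgue_measure
  ([set` `]0, t]] : set (lebR R))).
  congr completed_lebesgue_measure; apply: setIidl => x /=.
  rewrite in_itv /= => /andP[x0 xt]; exact: in_dom_le tJ (ltW x0) xt.
by rewrite completed_lebesgue_measure_itv lebesgue_measure_itv /= lte_fin t0 oppr0 adde0.
Qed.

Lemma ae_mu_imp (P Q : set R) : (forall x, P x -> Q x) ->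
  (\forall x \ae mu, P x) -> \forall x \ae mu, Q x.
Proof. by move=> PQ; apply: (@filterS _ _ (ae_filter_ringOfSetsType (mu : {measure set (lebR R) -> \bar R}))). Qed.

Lemma ae_mu_imp2 (P Q S : set R) : (forall x, P x -> Q x -> S x) ->
  (\forall x \ae mu, P x) -> (\forall x \ae mu, Q x) -> \forall x \ae mu, S x.
Proof. by move=> PQS; apply: (@filterS2 _ _ (ae_filter_ringOfSetsType (mu : {measure set (lebR R) -> \bar R}))). Qed.

Lemma mu_set1 : mu [set 0%R : R] = 0%E.
Proof.
apply/eqP; rewrite eq_le measure_ge0 andbT.
apply: le_trans (mu_itv0c (lexx 0)); apply: mu_le_sub => x [-> _] /=.
by rewrite in_itv /= !lexx.
Qed.

Lemma muT_gt0 : (0 < mu setT)%E.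
Proof.
apply: (@lt_le_trans _ _ (mu `]0%R, 1]%classic)); last exact: mu_le_sub.
rewrite mu_itvoc ?lte_fin//.
by case: hJ => ->; rewrite in_itv /= ler01 ?lexx.
Qed.

(** The point 0 and the complement of [J] are null. Conditions imposed only away from 0, such as
    monotonicity, therefore pass to almost-everywhere statements. *)
Lemma ae_mu_dom (P : set R) : (forall x, x \in J -> 0 < x -> P x) ->
  \forall x \ae mu, P x.
Proof.
move=> hP; exists (([set 0 : R] `|` ~` [set` J])); split.
- apply: measurableU; last exact/measurableC/measurable_itv_lebR.
  by rewrite -set_itv1; exact: measurable_itv_lebR.
- apply/eqP; rewrite eq_le measure_ge0 andbT -mu_set1.
  by apply: mu_le_sub => x [[->|]].
- move=> x /=; apply: contra_notP => /not_orP[x0 /contrapT xJ].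
  by apply: hP => //; rewrite lt_neqAle eq_sym in_dom_ge0 ?andbT//; exact/eqP.
Qed.

(** By monotonicity the part of a level set in the positive points of [J] is an interval; the value
    at 0 is arbitrary and adds at most one point. *)
Lemma lmeasurable_nonincreasing (f : R -> R) :
  (forall s t, s \in J -> t \in J -> 0 < s -> s <= t -> f t <= f s) ->
  lmeasurable J f.
Proof.
move=> fni; apply: (measurability _ (RGenOInfty.measurableE R)) => _ [_ [a ->] <-].
have -> : [set` J] `&` f @^-1` `]a, +oo[%classic =
    [set x | x = 0 /\ a < f 0] `|` [set x | [/\ x \in J, 0 < x & a < f x]].
  have fa x : (f @^-1` `]a, +oo[%classic) x = (a < f x).
    by rewrite /preimage /= in_itv /= andbT.
  apply/seteqP; split=> [x [xJ]|x].
    rewrite fa => ax; have [x0|x0] := ltP 0 x; [by right|left].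
    have x00 : x = 0 by apply/eqP; rewrite eq_le x0 in_dom_ge0.
    by split => //; rewrite -x00.
  by case=> [[-> af]|[xJ _ ax]]; split; rewrite ?fa//; exact: in_dom0.
apply: (@measurableU _ (lebR R)).
  have [af|af] := boolP (a < f 0).
    rewrite (_ : [set x | _] = [set` `[0, 0]]); first exact: measurable_itv_lebR.
    by rewrite set_itv1; apply/seteqP; split=> [x []|x ->].
  by rewrite (_ : [set x | _] = set0)//; apply/seteqP; split=> // x [].
apply: sub_caratheodory; apply: is_interval_measurable => s t /=.
move=> [sJ s0 fs] [tJ t0 ft] u /andP[su ut].
have uJ : u \in J by apply: in_dom_le tJ _ ut; apply: le_trans su; exact: ltW.
split => //; first exact: lt_le_trans su.
by apply: lt_le_trans ft _; apply: fni => //; exact: lt_le_trans su.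
Qed.

Lemma lmeasurable_indic (i : interval R) : lmeasurable J \1_([set` i]).
Proof.
apply: measurable_funTS; apply: measurable_indic; exact: measurable_itv_lebR.
Qed.

Lemma lmeasurable_trunc f t : lmeasurable J f -> lmeasurable J (trunc f t).
Proof. by move=> mf; apply: measurable_funM => //; exact: lmeasurable_indic. Qed.

End interval_measure.

(** * The nonincreasing rearrangement and its truncations *)

Section rearrangement.
Context {R : realType} {J : interval R}.
Hypothesis hJ : J = `[0, 1] \/ J = `[0, +oo[.
Local Notation mu := (mu J).
Implicit Types (f g u v : R -> R) (s t l : R).

Lemma rearr_ge0 f t : (0 <= rearr J f t)%E.
Proof. by apply: le_ereal_inf_tmp => _ [l [l0 _] <-]; rewrite lee_fin. Qed.

Lemma rearr_le f t l :
  0 <= l -> (mu [set x | (l < `|f x|)%R] <= t%:E)%E -> (rearr J f t <= l%:E)%E.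
Proof. by move=> l0 fl; apply: ereal_inf_lbound; exists l. Qed.

Lemma mu_distr_le f s l : s <= l ->
  (mu [set x | (l < `|f x|)%R] <= mu [set x | (s < `|f x|)%R])%E.
Proof. by move=> sl; apply: mu_le_sub => x [/= + _]; exact: le_lt_trans. Qed.

Lemma rearr_lt_distr f t l : (rearr J f t < l%:E)%E ->
  0 < l /\ (mu [set x | (l < `|f x|)%R] <= t%:E)%E.
Proof.
move=> /ereal_inf_lt[_ [s [s0 fs] <-]]; rewrite lte_fin => sl; split.
  exact: le_lt_trans sl.
exact: le_trans (mu_distr_le _ (ltW sl)) fs.
Qed.

Lemma rearr_ge f t l : (t%:E < mu [set x | (l < `|f x|)%R])%E ->
  (l%:E <= rearr J f t)%E.
Proof.
move=> tl; rewrite leNgt; apply/negP => /rearr_lt_distr[_].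
by rewrite leNgt tl.
Qed.

Lemma rearr_nonincreasing f s t : s <= t -> (rearr J f t <= rearr J f s)%E.
Proof.
move=> st; apply: ereal_inf_le_tmp => _ [l [l0 fl] <-]; exists l => //; split=> //.
by apply: le_trans fl _; rewrite lee_fin.
Qed.

(** Levels strictly above [x] suffice, so the infimum defining the rearrangement never has to be
    shown to be attained. *)
Lemma rearr_le_gt (x : \bar R) f t : (0 <= x)%E ->
  (forall l, (x < l%:E)%E -> (mu [set y | (l < `|f y|)%R] <= t%:E)%E) ->
  (rearr J f t <= x)%E.
Proof.
case: x => [r r0 h| |//]; last by move=> _ _; exact: leey.
apply/lee_addgt0Pr => e e0; rewrite -EFinD; apply: rearr_le.
  by rewrite addr_ge0// ltW.
by apply: h; rewrite lte_fin ltrDl.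
Qed.

Lemma rearr_ae_le f g t : (\forall x \ae mu, `|f x| <= `|g x|) ->
  (rearr J f t <= rearr J g t)%E.
Proof.
move=> fg; apply: rearr_le_gt; first exact: rearr_ge0.
move=> l /rearr_lt_distr[_]; apply: le_trans; apply: mu_le_ae.
by move: fg; apply: ae_mu_imp => x fgx /= lf; exact: lt_le_trans fgx.
Qed.

(** Almost everywhere [v] contributes at most [M], so [f] can exceed K(l + M) only where [u] exceeds
    [l]. *)
Lemma rearr_quasi_le (K M : R) f u v t l : 0 <= K -> 0 <= M ->
  (\forall x \ae mu, `|f x| <= K * (`|u x| + `|v x|)) ->
  (\forall x \ae mu, `|v x| <= M) ->
  (rearr J u t < l%:E)%E -> (rearr J f t <= (K * (l + M))%:E)%E.
Proof.
move=> K0 M0 fuv vM /rearr_lt_distr[l0 ul].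
apply: rearr_le; first by rewrite mulr_ge0// addr_ge0// ltW.
apply: le_trans ul; apply: mu_le_ae; move: fuv vM; apply: ae_mu_imp2 => x fx vx /=.
apply: contraTlt => ux; rewrite -leNgt (le_trans fx)//.
by rewrite ler_wpM2l// lerD.
Qed.

Lemma rearr_scale_ge (c : R) f t : 0 < c ->
  (c%:E * rearr J f t <= rearr J (fun x => c * f x)%R t)%E.
Proof.
move=> c0; apply: le_ereal_inf_tmp => _ [l [l0 fl] <-].
rewrite -lee_pdivlMl// -EFinM; apply: rearr_le.
  by rewrite mulr_ge0// invr_ge0 ltW.
apply: le_trans fl; apply: mu_le_sub => x [+ _] /=.
by rewrite /mkset normrM (gtr0_norm c0) ltr_pdivrMl.
Qed.

Lemma rearr_full f t : (mu setT <= t%:E)%E -> rearr J f t = 0%E.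
Proof.
move=> Jt; apply/eqP; rewrite eq_le rearr_ge0 andbT; apply: rearr_le => //.
by apply: le_trans Jt; exact: mu_le_sub.
Qed.

Lemma mu_le_dom t : 0 <= t -> t \notin J -> (mu setT <= t%:E)%E.
Proof.
move=> t0 tJ; apply: le_trans (mu_itv0c t0); apply: mu_le_sub => x [_ xJ].
rewrite /= in_itv /= (in_dom_ge0 hJ xJ) /= leNgt; apply/negP => tx.
by move/negP: tJ; apply; exact: (in_dom_le hJ xJ t0 (ltW tx)).
Qed.

(** [class_M] tests every t > 0, also those outside [J]. There [t] is at least the total measure,
    and the rearrangement is 0. *)
Lemma rearr_lty f : (forall t, t \in J -> 0 < t -> (rearr J f t < +oo)%E) ->
  forall t, 0 < t -> (rearr J f t < +oo)%E.
Proof.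
move=> h t t0; have [tJ|tJ] := boolP (t \in J); first exact: h.
by rewrite rearr_full ?ltry// mu_le_dom// ltW.
Qed.

Lemma rstarE f t : (rearr J f t < +oo)%E -> (rstar J f t)%:E = rearr J f t.
Proof. by move=> h; rewrite fineK// ge0_fin_numE// rearr_ge0. Qed.

Lemma rstar_ge0 f t : 0 <= rstar J f t.
Proof. by rewrite fine_ge0// rearr_ge0. Qed.

Lemma rstar_le f t l : 0 <= l -> (rearr J f t <= l%:E)%E -> rstar J f t <= l.
Proof.
move=> l0 fl; rewrite -lee_fin rstarE//.
by apply: le_lt_trans fl _; rewrite ltry.
Qed.

Lemma rstar_nonincreasing f s t : (rearr J f s < +oo)%E -> s <= t ->
  rstar J f t <= rstar J f s.
Proof.
move=> h st; apply: rstar_le; first exact: rstar_ge0.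
by rewrite rstarE//; exact: rearr_nonincreasing.
Qed.

Lemma lmeasurable_rstar f :
  (forall t, t \in J -> 0 < t -> (rearr J f t < +oo)%E) ->
  lmeasurable J (rstar J f).
Proof.
move=> h; apply: lmeasurable_nonincreasing => // s t sJ tJ s0 st.
by apply: rstar_nonincreasing => //; exact: h.
Qed.

Lemma normr_trunc f t x : `|trunc f t x| <= `|f x|.
Proof.
rewrite /trunc indicE normrM ler_piMr// ger0_norm//.
by case: (_ \in _); rewrite ?ler01.
Qed.

Lemma trunc_in f t x : 0 <= x -> x <= t -> trunc f t x = f x.
Proof. by move=> x0 xt; rewrite /trunc indicE mem_set ?mulr1//= in_itv/= x0. Qed.

Lemma trunc_out f t x : t < x -> trunc f t x = 0.
Proof.
move=> tx; rewrite /trunc indicE memNset ?mulr0//= in_itv/= => /andP[_].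
by rewrite leNgt tx.
Qed.

(** Beyond [s] the function f^* is at most f^*(s), so a level above f^*(s) is exceeded only inside
    [0,s]. *)
Lemma rearr_trunc_rstar_le f t s : 0 <= s ->
  (rearr J (trunc (rstar J f) t) s <= rearr J f s)%E.
Proof.
move=> s0; apply: rearr_le_gt; first exact: rearr_ge0.
move=> l fl; have [l0 fs] := rearr_lt_distr fl.
apply: le_trans (mu_itv0c s0); apply: mu_le_sub => x [/= lx Jx].
have x0 : 0 <= x by exact: in_dom_ge0 Jx.
rewrite in_itv /= x0 /= leNgt; apply/negP => sx.
move: lx; apply/negP; rewrite -leNgt; apply: le_trans (normr_trunc _ _ _) _.
rewrite ger0_norm ?rstar_ge0//; apply: rstar_le; first exact: ltW.
exact: le_trans (rearr_nonincreasing _ (ltW sx)) (ltW fl).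
Qed.

Lemma rearr_trunc0 f t s : 0 <= t -> t <= s -> rearr J (trunc f t) s = 0%E.
Proof.
move=> t0 ts; apply/eqP; rewrite eq_le rearr_ge0 andbT; apply: rearr_le => //.
apply: (@le_trans _ _ t%:E); last by rewrite lee_fin.
apply: le_trans (mu_itv0c t0); apply: mu_le_sub => x [/= lx Jx].
have x0 : 0 <= x by exact: in_dom_ge0 Jx.
rewrite in_itv /= x0 /= leNgt; apply/negP => /trunc_out fx.
by rewrite fx normr0 ltxx in lx.
Qed.

End rearrangement.

(** * L^oo, sums of spaces, and elementary consequences of the r.i. axioms *)

Section function_spaces.
Context {R : realType} {J : interval R}.
Hypothesis hJ : J = `[0, 1] \/ J = `[0, +oo[.
Local Notation mu := (mu J).
Implicit Types (f g u v a b : R -> R) (s t l : R) (A B X : fspace R).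

Lemma Linfty_leP f M : (Linfty J f <= M%:E)%E <-> \forall x \ae mu, `|f x| <= M.
Proof.
(* Positive total measure selects the branch of the norm that is an essential supremum. *)
rewrite /Linfty unlock (muT_gt0 hJ); split => [/ess_supP|] h.
  by move: h; apply: ae_mu_imp => x; rewrite /= lee_fin.
by apply/ess_supP; move: h; apply: ae_mu_imp => x; rewrite /= lee_fin.
Qed.

Lemma in_LinftyP f : in_space J (Linfty J) f -> exists M,
  [/\ 0 <= M, Linfty J f = M%:E & \forall x \ae mu, `|f x| <= M].
Proof.
move=> [_ fy]; have f0 : (0 <= Linfty J f)%E by exact: Lnorm_ge0.
have fE : (fine (Linfty J f))%:E = Linfty J f by rewrite fineK// ge0_fin_numE.
exists (fine (Linfty J f)); split => //; first exact: fine_ge0.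
by apply/Linfty_leP; rewrite fE.
Qed.

Lemma in_Linfty_ae f M : lmeasurable J f ->
  (\forall x \ae mu, `|f x| <= M) -> in_space J (Linfty J) f.
Proof.
by move=> mf /Linfty_leP fM; split=> //; apply: le_lt_trans fM _; rewrite ltry.
Qed.

Lemma sum_spaceP A B f : in_space J (sum_space J A B) f -> exists a b,
  [/\ in_space J A a, in_space J B b & f = a \+ b %[ae mu]].
Proof.
by move=> [_ /ereal_inf_lt[_ [a [b [Aa Bb fab ->]]] _]]; exists a, b.
Qed.

Lemma in_sum_space A B f a b : in_space J A a -> in_space J B b ->
  lmeasurable J f -> f = a \+ b %[ae mu] -> in_space J (sum_space J A B) f.
Proof.
move=> Aa Bb mf fab; split => //; apply: le_lt_trans (ereal_inf_lbound _) _.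
  by exists a, b; split.
by apply: lte_add_pinfty; [exact: Aa.2|exact: Bb.2].
Qed.

Lemma sum_space_left A B f : in_space J B (cst 0) -> in_space J A f ->
  in_space J (sum_space J A B) f.
Proof.
move=> B0 Af; apply: in_sum_space Af B0 Af.1 _.
by apply: (ae_mu_imp _ (ae_mu_dom hJ (fun x _ _ => erefl (f x)))) => x _ _ /=; rewrite addr0.
Qed.

Lemma sum_space_right A B f : in_space J A (cst 0) -> in_space J B f ->
  in_space J (sum_space J A B) f.
Proof.
move=> A0 Bf; apply: in_sum_space A0 Bf Bf.1 _.
by apply: (ae_mu_imp _ (ae_mu_dom hJ (fun x _ _ => erefl (f x)))) => x _ _ /=; rewrite add0r.
Qed.

Lemma in_Linfty0 : in_space J (Linfty J) (cst 0).
Proof.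
apply: (@in_Linfty_ae _ 0); first exact: measurable_cst.
by apply: ae_mu_dom => // x _ _; rewrite normr0.
Qed.

Section ri.
Context {K : R} {X : fspace R}.
Hypothesis hX : ri_space J K X.

Lemma in_space_fineK f : in_space J X f -> (fine (X f))%:E = X f.
Proof.
by move=> Xf; rewrite fineK// ge0_fin_numE ?(ri_ge0 hX Xf)//; exact: Xf.2.
Qed.

Lemma ri_le f g : in_space J X f -> lmeasurable J g ->
  (forall x, x \in J -> 0 < x -> `|g x| <= `|f x|) ->
  in_space J X g /\ (X g <= X f)%E.
Proof. by move=> Xf mg gf; apply: (ri_ideal hX) => //; exact: ae_mu_dom. Qed.

Lemma ri_indic t : in_space J X \1_([set` `[0, t]]).
Proof.
have mt : measurable ([set` `[0, t]] : set (lebR R)) by exact: measurable_itv_lebR.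
have := @ri_simple _ _ _ _ hX (indic_sfun _ mt : {sfun (lebR R) >-> R}).
apply; apply/integrableP; split; first exact/measurable_EFinP.
rewrite (eq_integral (fun x : lebR R => (\1_([set` `[0, t]] : set (lebR R)) x)%:E)); last first.
  by move=> x _; rewrite gee0_abs// lee_fin.
rewrite integral_indic// setIT.
have [t0|t0] := leP 0 t; first exact: le_lt_trans (mu_itv0c t0) (ltry _).
by rewrite set_itv_ge ?measure0 ?ltry// bnd_simp -ltNge.
Qed.

Lemma in_space0 : in_space J X (cst 0).
Proof.
apply: (ri_le (ri_indic 0) _ _).1; first exact: measurable_cst.
by move=> x _ _; rewrite normr0.
Qed.

Lemma ri_ae0 f : in_space J X f -> f = cst 0 %[ae mu] -> X f = 0%E.
Proof. by move=> Xf /(ri_eq0 hX Xf). Qed.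

Lemma ri_trunc_ae_bounded f M t : lmeasurable J f ->
  (\forall x \ae mu, `|f x| <= M) -> in_space J X (trunc f t).
Proof.
move=> mf fM; have [+ _] := ri_scale hX M (ri_indic t).
move=> XM; apply: (ri_ideal hX XM _ _).1; first exact: lmeasurable_trunc.
move: fM; apply: ae_mu_imp => x fM; rewrite /trunc !normrM ler_wpM2r//.
exact: le_trans (ler_norm _).
Qed.

(** A bounded function cut to [0,t] is dominated by a multiple of an indicator, hence lies in X.
    This makes Q_X f finite for every f in X + L^oo, in particular on Y. *)
Lemma ri_trunc_sum f t : in_space J (sum_space J X (Linfty J)) f ->
  in_space J X (trunc f t).
Proof.
move=> Sf; have [a [b [Xa Lb fab]]] := sum_spaceP Sf.
have [M [_ _ bM]] := in_LinftyP Lb.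
have Xat : in_space J X (trunc a t).
  apply: (ri_le Xa _ _).1; first exact/lmeasurable_trunc/Xa.1.
  by move=> x _ _; exact: normr_trunc.
have Xbt := ri_trunc_ae_bounded t Lb.1 bM.
have [Xab _] := ri_add hX Xat Xbt.
apply: (ri_ideal hX Xab _ _).1; first exact/lmeasurable_trunc/Sf.1.
move: fab; apply: ae_mu_imp => x /(_ I) /= fx.
by rewrite /trunc fx mulrDl.
Qed.

Lemma fundamentalE t : (fundamental X t)%:E = X \1_([set` `[0, t]]).
Proof. exact/in_space_fineK/ri_indic. Qed.

Lemma fundamental_ge0 t : 0 <= fundamental X t.
Proof. by rewrite -lee_fin fundamentalE; apply: (ri_ge0 hX); exact: ri_indic. Qed.

Lemma fundamental0 : fundamental X 0 = 0.
Proof.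
apply/eqP; rewrite -eqe fundamentalE; apply/eqP/ri_ae0; first exact: ri_indic.
apply: ae_mu_dom => // x _ x0 _; rewrite indicE memNset//= in_itv /= => /andP[_].
by rewrite leNgt x0.
Qed.

Lemma ri_cst_le f m s : in_space J X f -> 0 <= m ->
  (forall x, x \in J -> 0 < x -> x <= s -> m <= f x) ->
  (((fundamental X s) * m)%:E <= X f)%E.
Proof.
move=> Xf m0 mf; have [Xm XmE] := ri_scale hX m (ri_indic s).
rewrite EFinM muleC fundamentalE -[m in leLHS](ger0_norm m0) -XmE.
apply: (ri_le Xf Xm.1 _).2 => x xJ x0; rewrite indicE.
have [/set_mem/=|_] := boolP (x \in _); last by rewrite mulr0 normr0.
rewrite in_itv /= mulr1 => /andP[_ xs]; rewrite (ger0_norm m0).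
exact: le_trans (mf _ xJ x0 xs) (ler_norm _).
Qed.

Lemma ri_rearr_lty f : in_space J X f ->
  forall t, t \in J -> 0 < t -> (rearr J f t < +oo)%E.
Proof. by move=> Xf; have [[/(_ Xf)[]]] := ri_rearr hX Xf.1. Qed.

Lemma ri_rstar f : in_space J X f ->
  in_space J X (rstar J f) /\ X f = X (rstar J f).
Proof. by move=> Xf; have [[/(_ Xf)[_ ?] _] /(_ Xf)] := ri_rearr hX Xf.1. Qed.

End ri.
End function_spaces.

(** * The space M^*(X), and class M from the boundedness of Q_X *)

Section fundamental_function.
Context {R : realType} {J : interval R}.
Hypothesis hJ : J = `[0, 1] \/ J = `[0, +oo[.
Context {X : fspace R}.
Hypotheses (hX : ri_space J 1 X) (hphi : regular_fundamental J X).
Local Notation mu := (mu J).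
Local Notation phi := (fundamental X).
Implicit Types (f g u v a b : R -> R) (s t l : R).

Lemma rearr_quasi_le_le (K M : R) f u v t l : 0 < K -> 0 <= M ->
  (\forall x \ae mu, `|f x| <= K * (`|u x| + `|v x|)) ->
  (\forall x \ae mu, `|v x| <= M) ->
  (rearr J u t <= l%:E)%E -> (rearr J f t <= (K * (l + M))%:E)%E.
Proof.
move=> K0 M0 fuv vM ul; apply/lee_addgt0Pr => e e0.
(* The slack [e / K] gives the strict inequality required by [rearr_quasi_le]; the factor [K] turns
   it back into [e]. *)
rewrite -EFinD (_ : _ + e = K * ((l + e / K) + M)); last by field; rewrite gt_eqF.
apply: (rearr_quasi_le (ltW K0) M0 fuv vM); apply: le_lt_trans ul _.
by rewrite lte_fin ltrDl divr_gt0.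
Qed.

(** Concavity at the midpoint of 0 and [t], with [phi] zero at 0. The factor 2 in [rstar_le_QX] and
    in [QX_linear_majorant] comes from here. *)
Lemma fundamental_half t : t \in J -> phi t <= 2 * phi (t / 2).
Proof.
move=> tJ; have h0 : 0 <= 2^-1 :> R by lra.
have h1 : 2^-1 <= 1 :> R by lra.
have := @fundamental_concave _ _ _ hphi (Itv01 h0 h1) t 0.
rewrite !inE => /(_ tJ (in_dom0 hJ)).
change (- phi (2^-1 * t + (1 - 2^-1) * 0) <=
  2^-1 * - phi t + (1 - 2^-1) * - phi 0 -> phi t <= 2 * phi (t / 2)).
rewrite (fundamental0 hJ hX) oppr0 !mulr0 !addr0 mulrC => ?; lra.
Qed.

Lemma Mstar_ge f s : s \in J -> ((phi s)%:E * rearr J f s <= Mstar J X f)%E.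
Proof. by move=> sJ; apply: ereal_sup_ubound; exists s. Qed.

Lemma Mstar_ge0 f : (0 <= Mstar J X f)%E.
Proof.
apply: le_trans (Mstar_ge f (in_dom0 hJ)).
by rewrite mule_ge0 ?rearr_ge0// lee_fin (fundamental_ge0 hX).
Qed.

Lemma Mstar_le f (x : \bar R) : (0 <= x)%E ->
  (forall s, s \in J -> 0 < s -> ((phi s)%:E * rearr J f s <= x)%E) ->
  (Mstar J X f <= x)%E.
Proof.
move=> x0 h; apply: ge_ereal_sup => _ [s sJ <-].
have [s0|s0] := ltP 0 s; first exact: h.
have -> : s = 0 by apply/eqP; rewrite eq_le s0 (in_dom_ge0 hJ sJ).
by rewrite (fundamental0 hJ hX) mul0e.
Qed.

Lemma Mstar_le_ae f g : (\forall x \ae mu, `|f x| <= `|g x|) ->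
  (Mstar J X f <= Mstar J X g)%E.
Proof.
move=> fg; apply: Mstar_le; first exact: Mstar_ge0.
move=> s sJ s0; apply: le_trans (Mstar_ge g sJ).
by rewrite lee_wpmul2l ?lee_fin ?(fundamental_ge0 hX)//; exact: rearr_ae_le.
Qed.

(** The majorant c / phi is nonincreasing, so [|f|] exceeds the value of the majorant at [s] only
    inside [0,s]. *)
Lemma Mstar_le_majorant f c : 0 <= c ->
  (forall x, x \in J -> 0 < x -> `|f x| <= c / phi x) ->
  (Mstar J X f <= c%:E)%E.
Proof.
move=> c0 fc; apply: Mstar_le => // s sJ s0.
have phi0 : 0 < phi s := fundamental_gt0 hphi sJ s0.
rewrite -lee_pdivlMl// -EFinM; apply: rearr_le.
  by rewrite mulr_ge0// invr_ge0 ltW.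
apply: le_trans (mu_itv0c (ltW s0)); apply: mu_le_sub => x [/= cx xJ].
rewrite in_itv /= (in_dom_ge0 hJ xJ) /= leNgt; apply/negP => sx.
have x0 : 0 < x := lt_trans s0 sx.
have := lt_le_trans cx (fc _ xJ x0); apply/negP; rewrite -leNgt mulrC.
have sxphi := fundamental_nondecreasing hphi sJ xJ (ltW sx).
by rewrite ler_wpM2r// lef_pV2 ?posrE// (lt_le_trans phi0).
Qed.

Lemma rearr_lty_sum f : in_space J (sum_space J (Mstar J X) (Linfty J)) f ->
  forall t, t \in J -> 0 < t -> (rearr J f t < +oo)%E.
Proof.
move=> /sum_spaceP[a [b [Ma Lb fab]]] t tJ t0.
have [M [M0 _ bM]] := in_LinftyP hJ Lb.
have phi0 : 0 < phi t := fundamental_gt0 hphi tJ t0.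
have at' : (rearr J a t < +oo)%E.
  have := le_lt_trans (Mstar_ge a tJ) Ma.2.
  case: (rearr J a t) (rearr_ge0 (J := J) a t) => [r _ _|_|//]; first exact: ltry.
  by rewrite gt0_muley ?lte_fin.
apply: le_lt_trans (ltry (1 * (rstar J a t + M))).
apply: (@rearr_quasi_le_le 1 M f a b) => //; last by rewrite rstarE.
by move: fab; apply: ae_mu_imp => x /(_ I) ->; rewrite mul1r /= ler_normD.
Qed.

Section admissible.
Context {Y Z : fspace R}.
Hypothesis adm : admissible_couple J X (Mstar J X) (Y, Z).

Lemma admissible_in_sum f : in_space J Y f ->
  in_space J (sum_space J X (Linfty J)) f.
Proof. by case: adm => _ _ [_ [C h]] _ /h[]. Qed.

Lemma QXE f t : in_space J Y f -> t \in J -> 0 < t ->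
  ((phi t * QX X f t)%:E = X (trunc f t))%E.
Proof.
move=> Yf tJ t0; have phi0 : 0 < phi t := fundamental_gt0 hphi tJ t0.
rewrite /QX mulrA mulfV ?gt_eqF// mul1r (in_space_fineK hX)//.
exact/(ri_trunc_sum hJ hX)/admissible_in_sum.
Qed.

Lemma QX_ge0 f t : in_space J Y f -> t \in J -> 0 < t -> 0 <= QX X f t.
Proof.
move=> Yf tJ t0; have phi0 : 0 < phi t := fundamental_gt0 hphi tJ t0.
rewrite -(pmulr_rge0 _ phi0) -lee_fin QXE//; apply: (ri_ge0 hX).
exact/(ri_trunc_sum hJ hX)/admissible_in_sum.
Qed.

Lemma rstar_le_QX f g t : in_space J Y f ->
  in_space J (sum_space J (Mstar J X) (Linfty J)) g ->
  (Mstar J X (trunc (rstar J g) t) <= X (trunc f t))%E ->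
  t \in J -> 0 < t -> rstar J g t <= 2 * QX X f t.
Proof.
(* The level [l], strictly between the two sides, is exceeded by g^* on all of (0,t]. *)
move=> Yf Sg gf tJ t0; rewrite leNgt; apply/negP => /midf_lt[].
set l := (_ + _) / 2 => Ql lg.
have t20 : 0 < t / 2 by lra.
have t2J : t / 2 \in J by apply: (in_dom_le hJ tJ); lra.
have gy := rearr_lty_sum Sg.
(* A function supported in [0,t] has rearrangement 0 at [t], so the hypothesis is read at [t / 2],
   where a level set of measure at least [t] is large enough. *)
have l_rearr : (l%:E <= rearr J (trunc (rstar J g) t) (t / 2))%E.
  apply: rearr_ge; apply: (@lt_le_trans _ _ t%:E); first by rewrite lte_fin; lra.
  rewrite -(mu_itvoc hJ tJ t0); apply: mu_le_sub => x [x0t xJ] /=.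
  have /andP[x0 xt] : (0 < x) && (x <= t) by move: x0t; rewrite /= in_itv.
  rewrite trunc_in ?(ltW x0)//.
  rewrite ger0_norm ?rstar_ge0//; apply: lt_le_trans lg _.
  by apply: rstar_nonincreasing => //; exact: gy.
have phi20 : 0 < phi (t / 2) := fundamental_gt0 hphi t2J t20.
have : ((phi (t / 2) * l)%:E <= (phi t * QX X f t)%:E)%E.
  rewrite QXE//; apply: le_trans gf; apply: le_trans (Mstar_ge _ t2J).
  by rewrite EFinM lee_wpmul2l// lee_fin ltW.
rewrite lee_fin; apply/negP; rewrite -ltNge.
apply: (@le_lt_trans _ _ (phi (t / 2) * (2 * QX X f t))).
  by rewrite mulrA (mulrC _ 2) ler_wpM2r ?QX_ge0// fundamental_half.
by rewrite ltr_pM2l.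
Qed.

Lemma QX_bounded_class_M : QX_bounded J X Y Z ->
  class_M J X (Mstar J X) (Y, Z).
Proof.
(* The 2 is that of [rstar_le_QX]; the maximum meets the requirement 1 <= C of [class_M]. *)
move=> [K hK]; split => //; exists (Num.max 1 (2 * K)); first by rewrite le_max lexx.
move=> f g /= Yf Sg gf.
have [[KY _ /= hY] [KZ _ /= hZ] _ _] := adm.
have [Yfs YfE] := ri_rstar hY Yf.
have [ZQ QK] : in_space J Z (QX X (rstar J f)) /\
    (Z (QX X (rstar J f)) <= K%:E * Y (rstar J f))%E.
  apply: hK => // [t tJ t0|s t sJ tJ s0 st]; first exact: rstar_ge0.
  by apply: rstar_nonincreasing => //; apply: (ri_rearr_lty hY Yf).
have [Z2Q Z2QE] := ri_scale hZ 2 ZQ.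
have gy := rearr_lty_sum Sg.
have [Zgs Zgsle] : in_space J Z (rstar J g) /\
    (Z (rstar J g) <= Z (fun x => 2 * QX X (rstar J f) x)%R)%E.
  apply: (ri_le hJ hZ Z2Q); first exact: lmeasurable_rstar.
  move=> t tJ t0; rewrite ger0_norm ?rstar_ge0// (le_trans _ (ler_norm _))//.
  exact: (rstar_le_QX Yfs Sg (gf _ t0) tJ t0).
have Zg : in_space J Z g by apply/(ri_rearr hZ Sg.1).1; split.
split=> //=; rewrite (ri_rstar hZ Zg).2; apply: le_trans Zgsle _.
rewrite Z2QE normr_nat; apply: (@le_trans _ _ (2%:E * (K%:E * Y (rstar J f))))%E.
  by rewrite lee_wpmul2l// lee_fin.
rewrite muleA -EFinM YfE lee_wpmul2r//.
  by rewrite -YfE; exact: (ri_ge0 hY).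
by rewrite lee_fin le_max lexx orbT.
Qed.

End admissible.

End fundamental_function.

(** * Splitting a function at a height *)

Definition cut {R : realType} (m : R) (f : R -> R) (x : R) : R :=
  Num.max (- m) (Num.min (f x) m).

Definition excess {R : realType} (m : R) (f : R -> R) (x : R) : R :=
  f x - cut m f x.

Section cut.
Context {R : realType}.
Implicit Types (f : R -> R) (m x : R).

Lemma normr_cut m f x : 0 <= m -> `|cut m f x| <= m.
Proof.
move=> m0; rewrite /cut ler_norml le_max lexx /= ge_max ge_min lexx orbT andbT.
by lra.
Qed.

Lemma normr_excess_le m f x : 0 <= m -> `|excess m f x| <= `|f x|.
Proof.
move=> m0; rewrite /excess /cut.
have [fm|mf] := leP (f x) m; last first.
  have -> : Num.max (- m) m = m by apply/max_idPr; lra.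
  by rewrite !gtr0_norm; lra.
have [mf|fm'] := leP (- m) (f x); first by rewrite subrr normr0.
by rewrite !ltr0_norm; lra.
Qed.

(** The excess is nonzero only where [|f|] has passed [m], and there it equals [|f| - m] in absolute
    value: level sets are shifted by [m]. *)
Lemma normr_excess_gt m e f x : 0 <= m -> 0 <= e ->
  e < `|excess m f x| -> m + e < `|f x|.
Proof.
move=> m0 e0; rewrite /excess /cut.
have [fm|mf] := leP (f x) m.
  have [mf|fm'] := leP (- m) (f x); first by rewrite subrr normr0 => ?; lra.
  by rewrite !ltr_normr => /orP[?|?]; apply/orP; right; lra.
have -> : Num.max (- m) m = m by apply/max_idPr; lra.
by rewrite !ltr_normr => /orP[?|?]; apply/orP; left; lra.
Qed.

Lemma lmeasurable_cut (J : interval R) m f :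
  lmeasurable J f -> lmeasurable J (cut m f).
Proof.
move=> mf; apply: measurable_maxr; first exact: measurable_cst.
by apply: measurable_minr => //; exact: measurable_cst.
Qed.

Lemma lmeasurable_excess (J : interval R) m f :
  lmeasurable J f -> lmeasurable J (excess m f).
Proof. by move=> mf; apply: measurable_funB => //; exact: lmeasurable_cut. Qed.

End cut.

(** * From class M to quasilinear, linear and Lipschitz operators *)

Section class_M_consequences.
Context {R : realType} {J : interval R}.
Hypothesis hJ : J = `[0, 1] \/ J = `[0, +oo[.
Context {X : fspace R}.
Hypotheses (hX : ri_space J 1 X) (hphi : regular_fundamental J X).
Context {Y Z : fspace R}.
Hypothesis adm : admissible_couple J X (Mstar J X) (Y, Z).
Local Notation mu := (mu J).
Local Notation phi := (fundamental X).
Implicit Types (f g u v a b : R -> R) (s t l : R).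

Lemma admissible_rearr_lty f t : in_space J Y f -> 0 < t -> (rearr J f t < +oo)%E.
Proof.
case: adm => -[KY _ /= hY] _ _ _ Yf.
by apply: (rearr_lty hJ); exact: (ri_rearr_lty hY Yf).
Qed.

Lemma admissible_rstar f : in_space J Y f -> in_space J Y (rstar J f).
Proof. by case: adm => -[KY _ /= hY] _ _ _ /(ri_rstar hY)[]. Qed.

Lemma admissible_trunc f t : in_space J Y f -> in_space J X (trunc f t).
Proof. by move=> Yf; apply: (ri_trunc_sum hJ hX); exact: (admissible_in_sum adm). Qed.

(** The excess is above [l] only where [|f|] is above f^*(t) + l, a set of measure at most [t]. Its
    rearrangement hence vanishes from [t] on; it also lies below f^*, so f^* cut to [0,t] dominates
    it. *)
Lemma excess_in_X f t : in_space J Y f -> 0 < t ->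
  in_space J X (excess (rstar J f t) f) /\
  (X (excess (rstar J f t) f) <= X (trunc (rstar J f) t))%E.
Proof.
move=> Yf t0; set m := rstar J f t; set h := excess m f.
have m0 : 0 <= m by exact: rstar_ge0.
have hf s : (rearr J h s <= rearr J f s)%E.
  by apply: (rearr_ae_le); apply: ae_mu_dom => // x _ _; exact: normr_excess_le.
have hy s : s \in J -> 0 < s -> (rearr J h s < +oo)%E.
  by move=> _ s0; apply: le_lt_trans (hf s) _; exact: admissible_rearr_lty.
have ht s : t <= s -> rstar J h s = 0.
  move=> ts; apply/eqP; rewrite eq_le rstar_ge0 andbT; apply: rstar_le => //.
  apply: rearr_le_gt => // l; rewrite lte_fin => l0.
  have /rearr_lt_distr[_ fm] : (rearr J f t < (m + l)%:E)%E.
    by rewrite -rstarE ?admissible_rearr_lty// lte_fin ltrDl.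
  apply: (@le_trans _ _ t%:E); last by rewrite lee_fin.
  apply: le_trans fm; apply: mu_le_sub => x [/= + _].
  by apply: normr_excess_gt => //; exact: ltW.
have [Xhs hsle] : in_space J X (rstar J h) /\
    (X (rstar J h) <= X (trunc (rstar J f) t))%E.
  apply: (ri_le hJ hX (admissible_trunc t (admissible_rstar Yf))); first exact: lmeasurable_rstar.
  move=> x xJ x0; have [xt|tx] := ltP x t; last by rewrite ht// normr0.
  rewrite trunc_in ?(ltW x0) ?(ltW xt)// !ger0_norm ?rstar_ge0// -lee_fin.
  by rewrite !rstarE ?hy ?admissible_rearr_lty.
have Xh : in_space J X h.
  by apply/(ri_rearr hX (lmeasurable_excess _ Yf.1)).1; split.
by split=> //; rewrite (ri_rstar hX Xh).2.
Qed.

(* The K-functional estimate: [excess] and [cut] at the level f^*(t) split f in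
   X + L^oo optimally at the scale t. *)
Lemma Mstar_trunc_rstar_le f g (K C : R) t : in_space J Y f -> 0 < t ->
  1 <= K -> 0 <= C ->
  (exists u v, [/\ \forall x \ae mu, `|g x| <= K * (`|u x| + `|v x|),
    (Mstar J X u <= C%:E * X (excess (rstar J f t) f))%E &
    \forall x \ae mu, `|v x| <= C * rstar J f t]) ->
  (Mstar J X (trunc (rstar J g) t) <=
    (2 * K * C)%:E * X (trunc (rstar J f) t))%E.
Proof.
move=> Yf t0 K1 C0 [u [v [guv ule vle]]].
have K0 : 0 < K by lra.
have Xt := admissible_trunc t (admissible_rstar Yf).
have [Xe ele] := excess_in_X Yf t0.
set N := fine (X (trunc (rstar J f) t)).
have NE : N%:E = X (trunc (rstar J f) t) by exact: (in_space_fineK hX).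
have N0 : 0 <= N by rewrite -lee_fin NE; exact: (ri_ge0 hX).
have m0 : 0 <= rstar J f t by exact: rstar_ge0.
rewrite -NE -EFinM; apply: (Mstar_le hJ hX).
  by rewrite lee_fin !mulr_ge0// ltW.
move=> s sJ s0; have phi0 : 0 < phi s := fundamental_gt0 hphi sJ s0.
have [ts|st] := leP t s.
  by rewrite (rearr_trunc0 hJ _ (ltW t0) ts) mule0 lee_fin !mulr_ge0// ltW.
(* On (0,s] the function f^* is at least f^*(t). The bounded part thus costs no more than the part
   in X; the two together give the 2 in 2KC. *)
have mN : phi s * rstar J f t <= N.
  rewrite -lee_fin NE; apply: (ri_cst_le hJ hX Xt m0) => x xJ x0 xs.
  have xt := le_lt_trans xs st.
  rewrite trunc_in ?(ltW x0) ?(ltW xt)//; apply: rstar_nonincreasing; last exact: ltW.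
  exact: admissible_rearr_lty.
apply: (@le_trans _ _ ((phi s)%:E * rearr J g s)%E).
  rewrite lee_wpmul2l ?lee_fin ?(ltW phi0)//; exact: (rearr_trunc_rstar_le hJ _ _ (ltW s0)).
have us : (rearr J u s <= (C * N / phi s)%:E)%E.
  rewrite mulrC EFinM lee_pdivlMl//; apply: le_trans (Mstar_ge u sJ) _.
  by apply: le_trans ule _; rewrite EFinM lee_wpmul2l ?NE// lee_fin.
have gs := rearr_quasi_le_le K0 (mulr_ge0 C0 m0) guv vle us.
apply: (@le_trans _ _ ((phi s)%:E * (K * (C * N / phi s + C * rstar J f t))%:E)%E).
  by rewrite lee_wpmul2l// lee_fin ltW.
rewrite -EFinM lee_fin.
rewrite (_ : phi s * _ = K * C * (N + phi s * rstar J f t)); last first.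
  by field; rewrite gt_eqF.
rewrite (_ : 2 * K * C * N = K * C * (N + N)); last by ring.
by rewrite ler_wpM2l ?lerD2l// mulr_ge0// ltW.
Qed.

(** Class M compares two functions without a constant, so it is applied to [c] times [f], with c =
    2KC from the K-functional estimate. The pair [u], [v] may depend on [t], which allows a
    different cutting height at each scale. *)
Lemma class_M_bound (CM K C : R) f g : 1 <= CM ->
  (forall f g, in_space J Y f ->
    in_space J (sum_space J (Mstar J X) (Linfty J)) g ->
    (forall t, 0 < t ->
      (Mstar J X (trunc (rstar J g) t) <= X (trunc (rstar J f) t))%E) ->
    in_space J Z g /\ (Z g <= CM%:E * Y f)%E) ->
  in_space J Y f -> in_space J (sum_space J (Mstar J X) (Linfty J)) g ->
  1 <= K -> 1 <= C ->
  (forall t, 0 < t -> exists u v,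
    [/\ \forall x \ae mu, `|g x| <= K * (`|u x| + `|v x|),
      (Mstar J X u <= C%:E * X (excess (rstar J f t) f))%E &
      \forall x \ae mu, `|v x| <= C * rstar J f t]) ->
  in_space J Z g /\ (Z g <= (CM * (2 * K * C))%:E * Y f)%E.
Proof.
move=> CM1 hM Yf Sg K1 C1 huv; pose c := 2 * K * C.
have c0 : 0 < c by rewrite !mulr_gt0//; lra.
have [KY _ /= hY] : quasi_banach_ri J Y by case: adm.
have [Ycf YcfE] := ri_scale hY c Yf.
have [|Zg Zgle] := hM _ g Ycf Sg; last first.
  by split=> //; rewrite -/c EFinM -muleA -[c](gtr0_norm c0) -YcfE.
move=> t t0; have C0 : 0 <= C by lra.
apply: le_trans (Mstar_trunc_rstar_le Yf t0 K1 C0 (huv t t0)) _; rewrite -/c.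
have Xt := admissible_trunc t (admissible_rstar Yf).
have [Xct XctE] := ri_scale hX c Xt.
rewrite (gtr0_norm c0) in XctE; rewrite -XctE.
apply: (ri_le hJ hX (admissible_trunc t (admissible_rstar Ycf)) Xct.1 _).2.
have K0 : 0 <= K by lra.
move=> x xJ x0; have [tx|xt] := ltP t x; first by rewrite !trunc_out// mulr0.
rewrite !trunc_in ?(ltW x0)// !ger0_norm ?mulr_ge0 ?rstar_ge0 ?(ltW c0)//.
rewrite -lee_fin EFinM !rstarE ?admissible_rearr_lty//; exact: rearr_scale_ge.
Qed.

Lemma bounded_op_le (E F : fspace R) T : (forall f, in_space J E f -> (0 <= E f)%E) ->
  bounded_op J E F T -> exists2 C, 1 <= C & forall f, in_space J E f ->
    in_space J F (T f) /\ (F (T f) <= C%:E * E f)%E.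
Proof.
move=> E0 [C hC]; exists (Num.max 1 C); first by rewrite le_max lexx.
move=> f Ef; have [FT TC] := hC f Ef; split=> //; apply: le_trans TC _.
by rewrite lee_wpmul2r ?E0// lee_fin le_max lexx orbT.
Qed.

Lemma Linfty_ge0 f : (0 <= Linfty J f)%E.
Proof. exact: Lnorm_ge0. Qed.

Lemma cut_in_Linfty f m : 0 <= m -> lmeasurable J f ->
  in_space J (Linfty J) (cut m f) /\ (Linfty J (cut m f) <= m%:E)%E.
Proof.
move=> m0 mf; have cm : \forall x \ae mu, `|cut m f x| <= m.
  by apply: ae_mu_dom => // x _ _; exact: normr_cut.
by split; [exact: (in_Linfty_ae hJ (lmeasurable_cut _ mf) cm)|exact/(Linfty_leP hJ)].
Qed.

Lemma class_M_QLI : class_M J X (Mstar J X) (Y, Z) ->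
  class_QLI J X (Mstar J X) (Y, Z).
Proof.
move=> [_ [CM CM1 /= hM]]; split=> //= T [Tsum Tae] [_ [K K1 TK]] TX TL.
have [CX CX1 {}TX] := bounded_op_le (ri_ge0 hX) TX.
have [CL CL1 {}TL] := bounded_op_le (fun f _ => Linfty_ge0 f) TL.
pose C := Num.max CX CL; have C1 : 1 <= C by rewrite le_max CX1.
exists (CM * (2 * K * C)) => f Yf.
have Sf := admissible_in_sum adm Yf.
apply: class_M_bound => //; first exact: Tsum.
move=> t t0; have m0 : 0 <= rstar J f t by exact: rstar_ge0.
set m := rstar J f t in m0 *.
have [Xe _] := excess_in_X Yf t0; rewrite -/m in Xe.
have [Lc cm] := cut_in_Linfty m0 Yf.1.
exists (T (excess m f)), (T (cut m f)); split.
- have := TK _ _ (sum_space_left hJ (in_Linfty0 hJ) Xe)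
    (sum_space_right hJ (in_space0 hJ hX) Lc).
  by rewrite (_ : excess m f \+ cut m f = f)//; apply/funext => x /=; rewrite subrK.
- apply: le_trans (TX _ Xe).2 _; rewrite lee_wpmul2r ?(ri_ge0 hX)//.
  by rewrite lee_fin le_max lexx.
- apply/(Linfty_leP hJ); apply: le_trans (TL _ Lc).2 _; rewrite EFinM.
  apply: lee_pmul => //; rewrite ?lee_fin ?Linfty_ge0//; first by lra.
  by rewrite le_max lexx orbT.
Qed.

Lemma linear_op0 T : linear_op J (sum_space J X (Linfty J)) T -> \forall x \ae mu, T (cst 0) x = 0.
Proof.
have S0 : in_space J (sum_space J X (Linfty J)) (cst 0).
  exact: (sum_space_left hJ (in_Linfty0 hJ) (in_space0 hJ hX)).
move=> Tlin; have := Tlin 1 _ _ S0 S0.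
rewrite (_ : (fun x => _) = cst 0); last first.
  by apply/funext => x /=; rewrite mul1r addr0.
apply: ae_mu_imp => x /(_ I) /=; rewrite mul1r => /eqP.
by rewrite -subr_eq0 opprD addrA subrr sub0r oppr_eq0 => /eqP.
Qed.

Lemma class_QLI_LI : class_QLI J X (Mstar J X) (Y, Z) ->
  class_LI J X (Mstar J X) (Y, Z).
Proof.
move=> [_ h]; split=> // T Top Tlin; apply: h => //.
have S0 : in_space J (sum_space J X (Linfty J)) (cst 0).
  exact: (sum_space_left hJ (in_Linfty0 hJ) (in_space0 hJ hX)).
have T0 := linear_op0 Tlin.
split.
  move=> a f Sf; have := Tlin a _ _ Sf S0.
  rewrite (_ : (fun x => a * f x + _) = (fun x => a * f x)); last first.
    by apply/funext => x /=; rewrite addr0.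
  by move: T0; apply: ae_mu_imp2 => x T0 /(_ I) ->; rewrite T0 addr0 normrM.
exists 1 => // f g Sf Sg; have := Tlin 1 _ _ Sf Sg.
rewrite (_ : (fun x => 1 * f x + _) = f \+ g); last first.
  by apply/funext => x /=; rewrite mul1r.
by apply: ae_mu_imp => x /(_ I) ->; rewrite !mul1r ler_normD.
Qed.

(** A Lipschitz operator does not split sums, so T f is compared with T of the cut function, and
    both arguments must lie in X. On [0,1] they do, because truncation at 1 changes nothing and X
    contains L^oo and Y. Their difference is the excess. *)
Lemma class_M_LPI : J = `[0, 1] -> class_M J X (Mstar J X) (Y, Z) ->
  class_LPI J X (Mstar J X) (Y, Z).
Proof.
move=> J01 [_ [CM CM1 /= hM]]; split=> //= T [Tsum _] [TX _ [CX TXl]].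
move=> [TL T0 [CL TLl]] f Yf.
have Sf := admissible_in_sum adm Yf.
have Xtrunc g : lmeasurable J g -> in_space J X (trunc g 1) -> in_space J X g.
  move=> mg Xg; apply: (ri_le hJ hX Xg mg _).1 => x; rewrite J01 in_itv /=.
  by move=> /andP[x0 x1] _; rewrite trunc_in.
have Xf : in_space J X f by apply: (Xtrunc _ Yf.1); exact: (admissible_trunc 1 Yf).
pose C := Num.max 1 (Num.max CX CL); have C1 : 1 <= C by rewrite le_max lexx.
apply: (class_M_bound CM1 hM Yf (Tsum _ Sf) (lexx 1) C1 _).1 => t t0.
have m0 : 0 <= rstar J f t by exact: rstar_ge0.
set m := rstar J f t in m0 *.
have [Xe _] := excess_in_X Yf t0; rewrite -/m in Xe.
have [Lc cm] := cut_in_Linfty m0 Yf.1.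
have cm' : \forall x \ae mu, `|cut m f x| <= m by exact/(Linfty_leP hJ).
have Xc : in_space J X (cut m f).
  by apply: (Xtrunc _ Lc.1); exact: (ri_trunc_ae_bounded hX 1 Lc.1 cm').
exists (T f \- T (cut m f)), (T (cut m f)); split.
- apply: ae_mu_dom => // x _ _; rewrite mul1r; apply: le_trans (ler_normD _ _).
  by rewrite /= subrK.
- apply: le_trans (TXl _ _ Xf Xc) _; rewrite lee_wpmul2r ?(ri_ge0 hX)//.
  by rewrite lee_fin !le_max lexx /= orbT.
- have : (Linfty J (T (cut m f) \- T (cst 0))%R <= (C * m)%:E)%E.
    apply: le_trans (TLl _ _ Lc (in_Linfty0 hJ)) _.
    rewrite (_ : (cut m f \- cst 0)%R = cut m f); last first.
      by apply/funext => x /=; rewrite subr0.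
    apply: (@le_trans _ _ (C%:E * Linfty J (cut m f)))%E.
      by rewrite lee_wpmul2r ?Linfty_ge0// lee_fin !le_max lexx !orbT.
    by rewrite EFinM lee_wpmul2l// lee_fin; lra.
  move=> /(Linfty_leP hJ); move: T0; apply: ae_mu_imp2 => x /(_ I) /= ->.
  by rewrite subr0.
Qed.

End class_M_consequences.

(** * Rounding up to a power of 2 *)

Section dyadic.
Context {R : realType}.
Implicit Types (t : R).

(** For t > 0 this is 2 raised to the least integer not below the base-2 logarithm of t: the tau(t)
    of the overview. *)
Definition dyadic_ceil t : R := expR ((Num.ceil (ln t / ln 2))%:~R * ln 2).

Let ln2_gt0 : 0 < ln 2 :> R. Proof. by rewrite ln_gt0// ltr1n. Qed.

Lemma dyadic_ceil_gt0 t : 0 < dyadic_ceil t.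
Proof. exact: expR_gt0. Qed.

Lemma le_dyadic_ceil t : 0 < t -> t <= dyadic_ceil t.
Proof.
move=> t0; rewrite -[leLHS](lnK t0) ler_expR -ler_pdivrMr//; exact: ceil_ge.
Qed.

Lemma dyadic_ceil_half_lt t : 0 < t -> dyadic_ceil t / 2 < t.
Proof.
move=> t0; rewrite /dyadic_ceil -[X in _ / X](lnK (_ : 2 \is Num.pos)) ?posrE//.
rewrite -expRN -expRD -[ltRHS](lnK t0) ltr_expR.
rewrite -[X in _ - X]mul1r -mulrBl -ltr_pdivlMr//.
by have := ceilB1_lt (ln t / ln 2); rewrite intrB.
Qed.

(** As 1 is itself a power of 2, rounding up does not leave [0,1]. *)
Lemma dyadic_ceil_le1 t : 0 < t -> t <= 1 -> dyadic_ceil t <= 1.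
Proof.
move=> t0 t1; rewrite -expR0 ler_expR mulr_le0_ge0 ?(ltW ln2_gt0)//.
by rewrite lerz0 ceil_le0 mulr_le0_ge0 ?ln_le0// invr_ge0 ltW.
Qed.

(** The ceiling has countably many values, each taken on the preimage of a half-open interval under
    [g]. No regularity of [d] enters, which is what arbitrary choices of functionals demand. *)
Lemma measurable_comp_ceil (g : R -> R) (d : int -> R) : measurable_fun setT g ->
  measurable_fun setT (fun t => d (Num.ceil (g t))).
Proof.
move=> mg _ B mB; rewrite setTI.
pose A (i : int) := [set t | d i \in B /\ Num.ceil (g t) = i].
have mA i : measurable (A i).
  have [iB|iB] := boolP (d i \in B); last first.
    by rewrite (_ : A i = set0)//; apply/seteqP; split=> // t [/(negP iB)].
  rewrite (_ : A i = g @^-1` [set` `](i - 1)%:~R, i%:~R]]).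
    by rewrite -[X in measurable X]setTI; apply: mg => //; exact: measurable_itv.
  apply/seteqP; split=> t /=; rewrite in_itv /= -ceil_eq.
    by move=> [_ ->].
  by move=> /eqP ti.
rewrite (_ : _ @^-1` _ = (\bigcup_(n : nat) A n%:Z) `|` (\bigcup_(n : nat) A (- n%:Z))).
  by apply: measurableU; apply: bigcupT_measurable => n; exact: mA.
apply/seteqP; split=> [t /= dB|t /= [[n _ [/set_mem ? ->]]|[n _ [/set_mem ? ->]]]]//.
have [n [E|E]] : exists n : nat, Num.ceil (g t) = n%:Z \/ Num.ceil (g t) = - n%:Z.
- by case: (Num.ceil (g t)) => n; [exists n; left|exists n.+1; right; rewrite NegzE].
- by left; exists n => //; split=> //; rewrite -E; exact/mem_set.
- by right; exists n => //; split=> //; rewrite -E; exact/mem_set.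
Qed.

Lemma measurable_comp_dyadic_ceil (c : R -> R) :
  measurable_fun setT (fun t => c (dyadic_ceil t)).
Proof.
apply: (@measurable_comp_ceil (fun t => ln t / ln 2)
  (fun i => c (expR (i%:~R * ln 2)))).
by apply: measurable_funM => //; exact: measurable_ln.
Qed.

End dyadic.

Lemma lmeasurable_borel {R : realType} (J : interval R) (f : R -> R) :
  measurable_fun setT f -> lmeasurable J f.
Proof.
move=> mf; apply: measurable_funTS => _ B mB; rewrite setTI.
by apply: sub_caratheodory; rewrite -[X in measurable X]setTI; exact: mf.
Qed.

(** * The linear operator that dominates Q_X at a given function *)

Section linear_majorant.
Context {R : realType} {J : interval R}.
Hypothesis hJ : J = `[0, 1] \/ J = `[0, +oo[.
Context {X : fspace R}.
Hypotheses (hX : ri_space J 1 X) (hphi : regular_fundamental J X).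
Local Notation mu := (mu J).
Local Notation phi := (fundamental X).
Local Notation SX := (sum_space J X (Linfty J)).
Local Notation SM := (sum_space J (Mstar J X) (Linfty J)).
Implicit Types (f g u v a b : R -> R) (s t l : R).

(** The norm is a seminorm on representatives, so no quotient by null functions is formed. Its
    subadditivity is the triangle inequality with constant 1. *)
Lemma ri_norming f : in_space J X f -> exists h : (R -> R) -> R,
  [/\ forall (c : R) u v, in_space J X u -> in_space J X v ->
        h (fun x => c * u x + v x) = c * h u + h v,
      forall u, in_space J X u -> `|h u| <= fine (X u) &
      h f = fine (X f)].
Proof.
move=> Xf; apply: (@hahn_banach_norming R (R -> R^o) (in_space J X) (fine \o X)) => //.
- exact: (in_space0 hJ hX).
- move=> c u v Xu Xv; have [Xcu _] := ri_scale hX c Xu.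
  by have [] := ri_add hX Xcu Xv.
- move=> c u Xu; have [_ XcE] := ri_scale hX c Xu.
  by rewrite /= XcE fineM// -(in_space_fineK hX Xu).
- move=> u v Xu Xv; have [Xuv le_uv] := ri_add hX Xu Xv.
  rewrite -lee_fin /= (in_space_fineK hX Xuv) EFinD !(in_space_fineK hX)//.
  by rewrite mul1e in le_uv.
Qed.

Lemma dyadic_ceil_in t : t \in J -> 0 < t -> dyadic_ceil t \in J.
Proof.
case: hJ => ->; rewrite !in_itv /= => tJ t0.
  by rewrite (ltW (dyadic_ceil_gt0 t)) dyadic_ceil_le1//; case/andP: tJ.
by rewrite (ltW (dyadic_ceil_gt0 t)).
Qed.

Lemma QX_linear_majorant f0 : in_space J SX f0 -> exists T,
  [/\ operator J SX SM T /\ linear_op J SX T,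
      bounded_op J X (Mstar J X) T, bounded_op J (Linfty J) (Linfty J) T &
      forall t, t \in J -> 0 < t -> QX X f0 t <= 2 * T f0 t].
Proof.
move=> Sf0; have Xtr f s := @ri_trunc_sum _ _ hJ _ _ hX f s.
have /choice[h hP] s := ri_norming (Xtr f0 s Sf0).
pose T f t := h (dyadic_ceil t) (trunc f (dyadic_ceil t)) / phi (dyadic_ceil t).
have phi_gt0 t : t \in J -> 0 < t -> 0 < phi (dyadic_ceil t).
  by move=> tJ t0; apply: (fundamental_gt0 hphi) (dyadic_ceil_gt0 t); exact: dyadic_ceil_in.
have mT f : lmeasurable J (T f).
  apply: lmeasurable_borel.
  exact: (measurable_comp_dyadic_ceil (fun s => h s (trunc f s) / phi s)).
have Tle f t : in_space J SX f -> t \in J -> 0 < t ->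
    `|T f t| <= fine (X (trunc f (dyadic_ceil t))) / phi (dyadic_ceil t).
  move=> Sf tJ t0; have p0 := phi_gt0 t tJ t0.
  rewrite normrM normfV (gtr0_norm p0) ler_wpM2r ?invr_ge0 ?(ltW p0)//.
  by have [_ + _] := hP (dyadic_ceil t); apply; exact: Xtr.
have Tlin (c : R) f g t : in_space J SX f -> in_space J SX g ->
    T (fun x => c * f x + g x) t = c * T f t + T g t.
  move=> Sf Sg; have [+ _ _] := hP (dyadic_ceil t).
  move=> /(_ c _ _ (Xtr f (dyadic_ceil t) Sf) (Xtr g (dyadic_ceil t) Sg)) hE.
  rewrite /T mulrA -mulrDl -hE; congr (h _ _ / _).
  by apply/funext => x; rewrite /trunc mulrDl mulrA.
(* A functional dominated by the norm of X vanishes on functions that are zero almost everywhere, so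
   [T] respects a.e. equality. *)
have Tae f g t : in_space J SX f -> in_space J SX g -> f = g %[ae mu] ->
    T f t = T g t.
  move=> Sf Sg fg; have [hl hle _] := hP (dyadic_ceil t).
  have Xf := Xtr f (dyadic_ceil t) Sf; have Xg := Xtr g (dyadic_ceil t) Sg.
  have hE := hl (-1) _ _ Xg Xf.
  have [XNg _] := ri_scale hX (-1) Xg.
  have [Xd _] := ri_add hX XNg Xf.
  have := hle _ Xd; rewrite (ri_ae0 hX Xd); last first.
    move: fg; apply: ae_mu_imp => x /(_ I) + _ /=.
    by rewrite /trunc => ->; rewrite mulN1r addNr.
  rewrite normr_le0 => /eqP hd; rewrite /T; congr (_ / _).
  by have := hE; rewrite mulN1r [LHS]hd => /esym/eqP; rewrite addrC subr_eq0 => /eqP.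
have TX f : in_space J X f -> in_space J (Mstar J X) (T f) /\ (Mstar J X (T f) <= X f)%E.
  move=> Xf; have Sf := sum_space_left hJ (in_Linfty0 hJ) Xf.
  have Tf : (Mstar J X (T f) <= X f)%E.
    rewrite -(in_space_fineK hX Xf).
    apply: (Mstar_le_majorant hJ hX hphi); first exact/fine_ge0/(ri_ge0 hX Xf).
    move=> t tJ t0; apply: le_trans (Tle f t Sf tJ t0) _.
    have p0 : 0 < phi t := fundamental_gt0 hphi tJ t0.
    have tt : phi t <= phi (dyadic_ceil t).
      apply: (fundamental_nondecreasing hphi) => //; first exact: dyadic_ceil_in.
      exact: le_dyadic_ceil.
    apply: ler_pM; rewrite ?invr_ge0 ?(le_trans (ltW p0) tt)//.
    - exact/fine_ge0/(ri_ge0 hX)/Xtr.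
    - rewrite -lee_fin !(in_space_fineK hX)//; last exact: Xtr.
      apply: (ri_le hJ hX Xf _ _).2; first exact/lmeasurable_trunc/Xf.1.
      by move=> x _ _; exact: normr_trunc.
    - by rewrite lef_pV2 ?posrE//; exact: phi_gt0.
  by split=> //; split=> //; apply: le_lt_trans Tf Xf.2.
(* The function M 1_[0,s] has norm M phi(s) in X, and the denominator phi(s) cancels exactly. *)
have TL f : in_space J (Linfty J) f ->
    in_space J (Linfty J) (T f) /\ (Linfty J (T f) <= Linfty J f)%E.
  move=> Lf; have Sf := sum_space_right hJ (in_space0 hJ hX) Lf.
  have [M [M0 -> fM]] := in_LinftyP hJ Lf.
  have Tf : \forall x \ae mu, `|T f x| <= M.
    apply: ae_mu_dom => // t tJ t0; have p0 := phi_gt0 t tJ t0.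
    apply: le_trans (Tle f t Sf tJ t0) _; rewrite ler_pdivrMr//.
    set s := dyadic_ceil t; have [XM XME] := ri_scale hX M (ri_indic hX s).
    rewrite -lee_fin (in_space_fineK hX); last exact: Xtr.
    rewrite EFinM (fundamentalE hX) -[in leRHS](ger0_norm M0) -XME.
    apply: (ri_ideal hX XM _ _).2; first exact/lmeasurable_trunc/Lf.1.
    move: fM; apply: ae_mu_imp => x fM; rewrite /trunc !normrM ler_wpM2r//.
    exact: le_trans (ler_norm _).
  by split; [exact: (in_Linfty_ae hJ _ Tf)|exact/(Linfty_leP hJ)].
exists T; split.
- split; last by move=> c f g Sf Sg; apply: ae_mu_dom => // t _ _ _; exact: Tlin.
  split; last by move=> f g Sf Sg fg; apply: ae_mu_dom => // t _ _ _; exact: Tae.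
  move=> f Sf; have [a [b [Xa Lb fab]]] := sum_spaceP Sf.
  have Sa := sum_space_left hJ (in_Linfty0 hJ) Xa.
  have Sb := sum_space_right hJ (in_space0 hJ hX) Lb.
  apply: (in_sum_space (TX a Xa).1 (TL b Lb).1 (mT f)).
  apply: ae_mu_dom => // t _ _ _; rewrite /= -[T a t]mul1r -Tlin//.
  apply: Tae => //; last first.
    by move: fab; apply: ae_mu_imp => x /(_ I) fx _; rewrite fx mul1r.
  apply: (in_sum_space Xa Lb).
    apply: measurable_funD; last exact: Lb.1.
    by apply: measurable_funM; [exact: measurable_cst|exact: Xa.1].
  by apply: ae_mu_dom => // x _ _ _; rewrite mul1r.
- by exists 1 => f Xf; rewrite mul1e; exact: TX.
- by exists 1 => f Lf; rewrite mul1e; exact: TL.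
move=> t tJ t0; have p0 : 0 < phi t := fundamental_gt0 hphi tJ t0.
have q0 := phi_gt0 t tJ t0; have sJ := dyadic_ceil_in tJ t0.
have [_ _ hE] := hP (dyadic_ceil t); rewrite /T hE.
(* Half of the rounded point is below [t], so halving the argument of [phi] costs the only factor
   2. *)
have qp : phi (dyadic_ceil t) <= 2 * phi t.
  apply: le_trans (fundamental_half hJ hX hphi sJ) _; rewrite ler_wpM2l//.
  have s20 : 0 <= dyadic_ceil t / 2 by rewrite divr_ge0// ltW// dyadic_ceil_gt0.
  have st := ltW (dyadic_ceil_half_lt t0).
  by apply: (fundamental_nondecreasing hphi) => //; exact: (in_dom_le hJ tJ).
have N0 : 0 <= fine (X (trunc f0 (dyadic_ceil t))).
  exact/fine_ge0/(ri_ge0 hX)/Xtr.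
apply: (@le_trans _ _ ((phi t)^-1 * fine (X (trunc f0 (dyadic_ceil t))))).
  rewrite /QX ler_wpM2l ?invr_ge0 ?(ltW p0)//.
  rewrite -lee_fin !(in_space_fineK hX); [|exact: Xtr..].
  apply: (ri_le hJ hX (Xtr _ _ Sf0) _ _).2; first exact/lmeasurable_trunc/Sf0.1.
  move=> x _ x0; have [xt|tx] := leP x t; last by rewrite trunc_out// normr0.
  by rewrite !trunc_in ?(ltW x0)// (le_trans xt)// le_dyadic_ceil.
rewrite mulrA mulrAC ler_wpM2r// ler_pdivlMr//.
by rewrite mulrC ler_pdivrMr.
Qed.

End linear_majorant.

(** * From inclusion to boundedness of Q_X, and the equivalences *)

Section QX_boundedness.
Context {R : realType} {J : interval R}.
Hypothesis hJ : J = `[0, 1] \/ J = `[0, +oo[.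
Context {X : fspace R}.
Hypotheses (hX : ri_space J 1 X) (hphi : regular_fundamental J X).
Context {Y Z : fspace R}.
Hypothesis adm : admissible_couple J X (Mstar J X) (Y, Z).
Local Notation mu := (mu J).
Local Notation phi := (fundamental X).
Local Notation SX := (sum_space J X (Linfty J)).
Local Notation SM := (sum_space J (Mstar J X) (Linfty J)).
Implicit Types (f g u v a b : R -> R) (s t l : R).

Let QX_E := QXE hJ hX hphi adm.

Lemma QX_le (c : R) f g t : 0 <= c -> in_space J Y f -> in_space J Y g ->
  (forall x, x \in J -> 0 < x -> `|f x| <= c * `|g x|) ->
  t \in J -> 0 < t -> QX X f t <= c * QX X g t.
Proof.
move=> c0 Yf Yg fg tJ t0; have p0 : 0 < phi t := fundamental_gt0 hphi tJ t0.
rewrite -(ler_pM2l p0) -lee_fin QX_E// mulrCA EFinM QX_E//.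
have [Xcg XcgE] := ri_scale hX c (admissible_trunc hJ hX adm t Yg).
rewrite -[c in c%:E](ger0_norm c0) -XcgE.
apply: (ri_le hJ hX Xcg _ _).2; first exact/lmeasurable_trunc/Yf.1.
move=> x xJ x0; rewrite [leRHS]normrM (ger0_norm c0).
have [xt|tx] := leP x t; last by rewrite !trunc_out// normr0 mulr0.
by rewrite !trunc_in ?(ltW x0)//; exact: fg.
Qed.

(** Both factors are monotone: 1 / phi decreases, and the norm of the truncation increases, so its
    opposite is used. *)
Lemma lmeasurable_QX f : in_space J Y f -> lmeasurable J (QX X f).
Proof.
move=> Yf; apply: measurable_funM.
  apply: (lmeasurable_nonincreasing hJ (f := fun t => (phi t)^-1)) => s t sJ tJ s0 st.
  have ps : 0 < phi s := fundamental_gt0 hphi sJ s0.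
  have pst := fundamental_nondecreasing hphi sJ tJ st.
  by rewrite lef_pV2// posrE// (lt_le_trans ps).
rewrite (_ : (fun t => _) = \- (fun t => - fine (X (trunc f t)))); last first.
  by apply/funext => t /=; rewrite opprK.
apply: measurable_funN.
apply: (lmeasurable_nonincreasing hJ (f := fun t => - fine (X (trunc f t)))).
move=> s t sJ tJ s0 st; rewrite lerN2 -lee_fin !(in_space_fineK hX); last 2 first.
- exact: (admissible_trunc hJ hX adm).
- exact: (admissible_trunc hJ hX adm).
apply: (ri_le hJ hX (admissible_trunc hJ hX adm t Yf) _ _).2.
  exact/lmeasurable_trunc/Yf.1.
move=> x xJ x0; have [xs|sx] := leP x s; last by rewrite trunc_out// normr0.
by rewrite !trunc_in ?(ltW x0)// (le_trans xs).
Qed.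

(* Gliding hump: unbounded normalized f_n would sum to a single f with QX f
   outside Z. *)
Lemma QX_bounded_of_maps :
  (forall f, in_space J Y f -> in_space J Z (QX X f)) -> QX_bounded J X Y Z.
Proof.
move=> QZ; apply: contrapT => /forallNP nQ.
have [[K K1 /= hY] [KZ _ /= hZ] _ _] := adm.
have K0 : 0 < K by lra.
(* Geometric weights that beat the quasi-triangle constant of Y: K times twice (2K)^-(j+1) is
   (2K)^-j, so the bound on the tails [S j N] reproduces itself when the first term is peeled
   off. *)
pose c n : R := (2 * K) ^+ n.+1.
have c0 n : 0 < c n by rewrite exprn_gt0// mulr_gt0.
have /choice[f fP] n : exists f, [/\ in_space J Y f,
    (forall t, t \in J -> 0 < t -> 0 <= f t),
    (forall s t, s \in J -> t \in J -> 0 < s -> s <= t -> f t <= f s) &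
    ((n%:R * c n)%:E * Y f < Z (QX X f))%E].
  have /existsNP[f] := nQ (n%:R * c n).
  move=> /not_implyP[Yf] /not_implyP[f0] /not_implyP[fni] fn.
  exists f; split=> //; rewrite ltNge; apply/negP => h; apply: fn.
  by split=> //; exact: QZ.
have Yf n : in_space J Y (f n) by case: (fP n).
have f0 n t : t \in J -> 0 < t -> 0 <= f n t by case: (fP n) => _ + _ _; exact.
have fni n s t : s \in J -> t \in J -> 0 < s -> s <= t -> f n t <= f n s.
  by case: (fP n) => _ _ + _; exact.
have fZ n : ((n%:R * c n)%:E * Y (f n) < Z (QX X (f n)))%E by case: (fP n).
pose y n := fine (Y (f n)).
have yE n : (y n)%:E = Y (f n) by exact: (in_space_fineK hY).
(* If [Y (f n)] were 0, then [f n] and Q_X of it would vanish almost everywhere, against the strict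
   inequality [fZ]. *)
have y0 n : 0 < y n.
  rewrite lt_neqAle fine_ge0 ?(ri_ge0 hY)// andbT eq_sym; apply/eqP => yn.
  have fn0 : f n = cst 0 %[ae mu] by apply/(ri_eq0 hY (Yf n)); rewrite -yE yn.
  have := fZ n; rewrite -yE yn mule0 (ri_ae0 hZ (QZ _ (Yf n))) ?ltxx//.
  apply: ae_mu_dom => // t tJ t0 _; apply/eqP.
  have p0 : 0 < phi t := fundamental_gt0 hphi tJ t0.
  rewrite -(mulrI_eq0 _ (mulfI (lt0r_neq0 p0))) -eqe QX_E//; apply/eqP.
  apply: (ri_ae0 hX (admissible_trunc hJ hX adm t (Yf n))).
  by move: fn0; apply: ae_mu_imp => x /(_ I) fx _; rewrite /trunc fx mul0r.
pose g n x := (c n * y n)^-1 * f n x.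
have cy0 n : 0 < c n * y n by rewrite mulr_gt0.
have g0 n t : t \in J -> 0 < t -> 0 <= g n t.
  by move=> tJ t0; rewrite mulr_ge0 ?f0// invr_ge0 ltW.
have [Yg YgE] : (forall n, in_space J Y (g n)) /\ forall n, Y (g n) = (c n)^-1%:E.
  have Ygn n := ri_scale hY (c n * y n)^-1 (Yf n).
  split=> n; first exact: (Ygn n).1.
  rewrite (Ygn n).2 -yE -EFinM gtr0_norm ?invr_gt0//; congr EFin.
  by field; rewrite !gt_eqF.
pose S j N x : R := \sum_(i < N) g (j + i)%N x.
have SY N j : in_space J Y (S j N) /\ (Y (S j N) <= ((2 * K) ^- j)%:E)%E.
  elim: N j => [|N IH] j.
    rewrite (_ : S j 0%N = cst 0); last by apply/funext => x; rewrite /S big_ord0.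
    split; first exact: (in_space0 hJ hY).
    rewrite (ri_ae0 hY (in_space0 hJ hY)); last exact: (ae_mu_dom hJ).
    by rewrite lee_fin invr_ge0 exprn_ge0// mulr_ge0// ltW.
  rewrite (_ : S j N.+1 = g j \+ S j.+1 N); last first.
    apply/funext => x; rewrite /S big_ord_recl addn0; congr (_ + _).
    by apply: eq_bigr => i _; rewrite addSnnS.
  have [YS YSle] := IH j.+1; have [YgS YgSle] := ri_add hY (Yg j) YS.
  split=> //; apply: le_trans YgSle _; rewrite YgE.
  apply: (@le_trans _ _ (K%:E * ((c j)^-1%:E + ((2 * K) ^- j.+1)%:E))%E).
    by rewrite lee_wpmul2l ?leeD2l// lee_fin ltW.
  rewrite -EFinD -EFinM lee_fin /c exprS le_eqVlt; apply/orP; left; apply/eqP.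
  by field; rewrite !gt_eqF ?exprn_gt0 ?mulr_gt0.
pose u := S 0%N.
have u0 N t : t \in J -> 0 < t -> 0 <= u N t.
  by move=> tJ t0; apply: sumr_ge0 => i _; exact: g0.
have uS N t : t \in J -> 0 < t -> u N t <= u N.+1 t.
  by move=> tJ t0; rewrite /u /S big_ord_recr /= lerDl g0.
pose s (x : R) := ereal_sup (range (fun n => (u n x)%:E)).
have [sfin Ys _] : [/\ \forall x \ae mu, s x \is a fin_num,
    in_space J Y (fine \o s) &
    Y (fine \o s) = ereal_sup (range (fun n => Y (u n)))].
  apply: (ri_fatou hY) => [n|n|n|].
  - exact: (SY n 0%N).1.
  - by apply: ae_mu_dom => // t; exact: u0.
  - by apply: ae_mu_dom => // t; exact: uS.
  - apply: le_lt_trans (ltry 1); apply: ge_ereal_sup => _ [n _ <-].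
    by have := (SY n 0%N).2; rewrite expr0 invr1.
have sni x t : x \in J -> t \in J -> 0 < x -> x <= t -> (s t <= s x)%E.
  move=> xJ tJ x0 xt; apply: ge_ereal_sup => _ [n _ <-].
  apply: (@le_trans _ _ (u n x)%:E); last by apply: ereal_sup_ubound; exists n.
  rewrite lee_fin; apply: ler_sum => i _.
  by rewrite ler_wpM2l ?fni// invr_ge0 ltW.
have s_ge0 t : t \in J -> 0 < t -> (0 <= s t)%E.
  move=> tJ t0; apply: (@le_trans _ _ (u 0%N t)%:E); first by rewrite lee_fin u0.
  by apply: ereal_sup_ubound; exists 0%N.
(* Fatou gives finiteness only almost everywhere. As [s] is nonincreasing, an infinite value at [t]
   would persist on (0,t], a set of positive measure. *)
have s_fin t : t \in J -> 0 < t -> s t \is a fin_num.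
  move=> tJ t0; apply: contrapT => st.
  have : mu `]0%R, t]%classic = 0%E.
    apply: negligible_mu0; apply: negligibleS sfin => x x0t /=.
    have /andP[x0 xt] : (0 < x) && (x <= t) by move: x0t; rewrite /= in_itv.
    have xJ := in_dom_le hJ tJ (ltW x0) xt; move=> sx; apply: st.
    rewrite ge0_fin_numE ?s_ge0//; apply: le_lt_trans (sni x t _ _ _ _) _ => //.
    by rewrite -ge0_fin_numE ?s_ge0.
  by rewrite (mu_itvoc hJ tJ t0) => /eqP; rewrite eqe gt_eqF.
have gs n t : t \in J -> 0 < t -> g n t <= fine (s t).
  move=> tJ t0; rewrite -lee_fin fineK ?s_fin//.
  apply: (@le_trans _ _ (u n.+1 t)%:E); last by apply: ereal_sup_ubound; exists n.+1.
  by rewrite lee_fin /u /S big_ord_recr /= add0n lerDr u0.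
have ZQ := QZ _ Ys.
pose z := fine (Z (QX X (fine \o s))).
have zE : z%:E = Z (QX X (fine \o s)) by exact: (in_space_fineK hZ).
(* Since [s] dominates [g n], the weight [c n * y n] appears on both sides of the chain from [fZ]
   and cancels, leaving [z] above every integer. *)
have nz (n : nat) : n%:R < z.
  have Qle t : t \in J -> 0 < t ->
      QX X (f n) t <= c n * y n * QX X (fine \o s) t.
    apply: QX_le => //; first exact: ltW.
    move=> x xJ x0; rewrite ger0_norm ?f0// ger0_norm ?fine_ge0 ?s_ge0//.
    by rewrite mulrC -ler_pdivrMr// mulrC; exact: gs.
  have [Zc ZcE] := ri_scale hZ (c n * y n) ZQ.
  have := fZ n; rewrite -yE -EFinM => /lt_le_trans h.
  have {}h : ((n%:R * c n * y n)%:E < Z (fun x => c n * y n * QX X (fine \o s) x)%R)%E.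
    apply: h; apply: (ri_le hJ hZ Zc (lmeasurable_QX (Yf n)) _).2 => t tJ t0.
    rewrite ger0_norm ?(QX_ge0 hJ hX hphi adm)//.
    by apply: le_trans (ler_norm _); exact: Qle.
  move: h; rewrite ZcE -zE -EFinM lte_fin gtr0_norm//.
  by rewrite -mulrA [ltRHS]mulrC ltr_pM2r.
have [n] : exists n : nat, z < n%:R by exists (Num.truncn `|z|).+1; apply: le_lt_trans (ler_norm _) (truncnS_gt _).
by have := nz n => /lt_trans h /h; rewrite ltxx.
Qed.

(** The hypothesis asks only for membership of [T f] in Z, the form that both the linear and the
    Lipschitz class can supply. *)
Lemma QX_maps_of_linear :
  (forall T, operator J SX SM T -> linear_op J SX T ->
    bounded_op J X (Mstar J X) T -> bounded_op J (Linfty J) (Linfty J) T ->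
    forall f, in_space J Y f -> in_space J Z (T f)) ->
  forall f, in_space J Y f -> in_space J Z (QX X f).
Proof.
move=> hT f Yf.
have [T [[Top Tlin] TX TL Tle]] :=
  QX_linear_majorant hJ hX hphi (admissible_in_sum adm Yf).
have ZT := hT T Top Tlin TX TL f Yf.
have [_ [KZ _ /= hZ] _ _] := adm.
have [Z2T _] := ri_scale hZ 2 ZT.
apply: (ri_le hJ hZ Z2T (lmeasurable_QX Yf) _).1 => t tJ t0.
rewrite ger0_norm ?(QX_ge0 hJ hX hphi adm)//.
by apply: le_trans (ler_norm _); exact: Tle.
Qed.

Lemma class_LI_QX_bounded : class_LI J X (Mstar J X) (Y, Z) ->
  QX_bounded J X Y Z.
Proof.
move=> [_ h]; apply/QX_bounded_of_maps/QX_maps_of_linear => T Top Tlin TX TL f Yf.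
by have [C /(_ f Yf)[]] := h T Top Tlin TX TL.
Qed.

(** This turns boundedness into a Lipschitz bound; a pointwise inequality suffices because the norms
    of M^*(X) and L^oo are monotone. *)
Lemma linear_opB T f g : linear_op J SX T -> in_space J SX f ->
  in_space J SX g -> \forall x \ae mu, `|(T f \- T g) x| <= `|T (f \- g) x|.
Proof.
move=> Tlin Sf Sg; have := Tlin (-1) _ _ Sg Sf.
rewrite (_ : (fun x => -1 * g x + f x) = f \- g); last first.
  by apply/funext => x /=; rewrite mulN1r addrC.
by apply: ae_mu_imp => x /(_ I) /= ->; rewrite mulN1r addrC.
Qed.

Lemma in_LinftyB f g : in_space J (Linfty J) f -> in_space J (Linfty J) g ->
  in_space J (Linfty J) (f \- g).
Proof.
move=> Lf Lg; have [M [_ _ fM]] := in_LinftyP hJ Lf.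
have [N [_ _ gN]] := in_LinftyP hJ Lg.
apply: (@in_Linfty_ae _ _ hJ _ (M + N)).
  by apply: measurable_funB; [exact: Lf.1|exact: Lg.1].
move: fM gN; apply: ae_mu_imp2 => x fx gx.
by apply: le_trans (ler_normB _ _) _; exact: lerD.
Qed.

Lemma ri_spaceB f g : in_space J X f -> in_space J X g -> in_space J X (f \- g).
Proof.
move=> Xf Xg; have [XNg _] := ri_scale hX (-1) Xg.
have [+ _] := ri_add hX Xf XNg.
by rewrite (_ : f \+ _ = f \- g)//; apply/funext => x /=; rewrite mulN1r.
Qed.

Lemma class_LPI_QX_bounded : class_LPI J X (Mstar J X) (Y, Z) ->
  QX_bounded J X Y Z.
Proof.
move=> [_ h]; apply/QX_bounded_of_maps/QX_maps_of_linear => T Top Tlin TX TL f Yf.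
have SX_X g := @sum_space_left _ _ hJ X (Linfty J) g (in_Linfty0 hJ).
have SX_L g := @sum_space_right _ _ hJ X (Linfty J) g (in_space0 hJ hX).
have T0 : T (cst 0) = cst 0 %[ae mu].
  by have := linear_op0 hJ hX Tlin; apply: ae_mu_imp => x -> _.
apply: h => //.
- have [C hC] := TX; split=> //; first by move=> g /hC[].
  exists C => g1 g2 Xg1 Xg2; have [_ TC] := hC _ (ri_spaceB Xg1 Xg2).
  apply: le_trans TC; apply: (Mstar_le_ae hJ hX).
  by apply: linear_opB => //; exact: SX_X.
- have [C hC] := TL; split=> //; first by move=> g /hC[].
  exists C => g1 g2 Lg1 Lg2; have [LT TC] := hC _ (in_LinftyB Lg1 Lg2).
  apply: le_trans TC; have [M [_ -> TM]] := in_LinftyP hJ LT.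
  apply/(Linfty_leP hJ).
  have := linear_opB Tlin (SX_L _ Lg1) (SX_L _ Lg2); move: TM.
  by apply: ae_mu_imp2 => x TM /le_trans; apply.
Qed.

(** The cycle Q_X bounded, M, QLI, LI, Q_X bounded settles three classes. LPI follows from M and in
    turn gives the boundedness of Q_X. *)
Lemma classes_QX_bounded :
  [/\ class_LI J X (Mstar J X) (Y, Z) <-> QX_bounded J X Y Z,
      class_QLI J X (Mstar J X) (Y, Z) <-> QX_bounded J X Y Z,
      class_M J X (Mstar J X) (Y, Z) <-> QX_bounded J X Y Z &
      J = `[0, 1] ->
        (class_LPI J X (Mstar J X) (Y, Z) <-> QX_bounded J X Y Z)].
Proof.
have Q_M := QX_bounded_class_M hJ hX hphi adm.
have M_QLI := class_M_QLI hJ hX hphi adm.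
have QLI_LI := class_QLI_LI hJ hX adm.
have LI_Q := class_LI_QX_bounded.
split; last move=> J01; split.
- exact: LI_Q.
- by move=> /Q_M/M_QLI/QLI_LI.
- by move=> /QLI_LI/LI_Q.
- by move=> /Q_M/M_QLI.
- by move=> /M_QLI/QLI_LI/LI_Q.
- exact: Q_M.
- exact: class_LPI_QX_bounded.
- by move=> /Q_M; exact: (class_M_LPI hJ hX hphi adm J01).
Qed.

End QX_boundedness.

Theorem proposition5 (R : realType) (J : interval R)
    (hJ : J = `[0, 1] \/ J = `[0, +oo[)
    (X : fspace R) (hX : banach_ri J X) (hphi : regular_fundamental J X) :
  [/\ class_LI J X (Mstar J X) = class_QLI J X (Mstar J X),
      class_QLI J X (Mstar J X) = class_M J X (Mstar J X),
      J = `[0, 1] -> class_M J X (Mstar J X) = class_LPI J X (Mstar J X) &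
      forall Y Z : fspace R, admissible_couple J X (Mstar J X) (Y, Z) ->
        [/\ class_LI J X (Mstar J X) (Y, Z) <-> QX_bounded J X Y Z,
            class_QLI J X (Mstar J X) (Y, Z) <-> QX_bounded J X Y Z,
            class_M J X (Mstar J X) (Y, Z) <-> QX_bounded J X Y Z &
            J = `[0, 1] ->
              (class_LPI J X (Mstar J X) (Y, Z) <-> QX_bounded J X Y Z)]].
Proof.
have Q Y Z := @classes_QX_bounded R J hJ X hX.1 hphi Y Z.
(* Membership in any class includes admissibility, so the equivalences for admissible couples give
   equality of the classes as sets. *)
split=> [|| J01|//]; apply/seteqP; split=> -[Y Z] YZ; have [adm _] := YZ;
  have [LI QLI M LPI] := Q Y Z adm.
- exact/QLI/LI.
- exact/LI/QLI.
- exact/M/QLI.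
- exact/QLI/M.
- exact/(LPI J01)/M.
- exact/M/(LPI J01).
Qed.
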